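(* Let $t\ge 3$ be an odd integer. If $G$ is a planar graph of maximum degree $d\ge t+2$ and girth at least $30t-6$, then $\chi'_t(G)\le \tau'_t(d)$, where $\tau'_t(d)=\frac{1}{d-2}\big(d(d-1)^{(t+1)/2}-d\big)$.
   Context: Graphs are simple. The line graph $L(G)$ has vertex set $E(G)$, two distinct edges being adjacent iff they share an endpoint; the distance between two edges is their distance in $L(G)$. The distance-$t$ chromatic index $\chi'_t(G)$ is the least number of colours in a colouring of $E(G)$ in which any two distinct edges at distance at most $t$ receive different colours. The girth is the length of a shortest cycle (infinite for forests). *)

(* Defs.v *)
From HB Require Import structures.
From mathcomp Require Import all_boot all_order all_algebra.
From mathcomp Require Import all_classical all_reals all_analysis.

Set Implicit Arguments.
Unset Strict Implicit.
Unset Printing Implicit Defensive.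

Import Order.TTheory GRing.Theory Num.Theory.
Import numFieldNormedType.Exports.

Record sgraph := SGraph {
  vertex :> finType;
  adj : rel vertex;
  adj_sym : symmetric adj;
  adj_irrefl : irreflexive adj }.

Definition degree (G : sgraph) (x : G) : nat := #|[pred y | adj x y]|.

Definition max_degree (G : sgraph) : nat := \max_(x : G) degree x.

(* Lengths and distances are valued in [option nat], [None] being infinity. *)
Definition ext_leq (m n : option nat) : bool :=
  match m, n with
  | _, None => true
  | None, Some _ => false
  | Some a, Some b => (a <= b)%N
  end.

Definition walk (G : sgraph) (n : nat) (x y : G) : bool :=
  [exists p : n.-tuple G, path (@adj G) x p && (last x p == y)].

(* A shortest walk has fewer than #|G| steps, so the bound loses nothing. *)
Definition distance (G : sgraph) (x y : G) : option nat :=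
  ohead [seq n <- iota 0 #|G| | walk n x y].

(* The lower bound on [n] excludes [::], and [:: x; y], for which [ucycle]
   would traverse a single edge back and forth. *)
Definition has_cycle (G : sgraph) (n : nat) : bool :=
  (2 < n)%N && [exists c : n.-tuple G, ucycleb (@adj G) c].

Definition girth (G : sgraph) : option nat :=
  ohead [seq n <- iota 0 #|G|.+1 | has_cycle G n].

Definition edges (G : sgraph) : {set {set G}} :=
  [set A : {set G} | [exists x, exists y, adj x y && (A == [set x; y]%SET)]].

Definition edge (G : sgraph) : finType := {A : {set G} | A \in edges G}.

Definition line_adj (G : sgraph) : rel (edge G) :=
  fun e f => (e != f) && (val e :&: val f != finset.set0)%SET.

Fact line_adj_sym (G : sgraph) : symmetric (@line_adj G).
Proof. by move=> e f; rewrite /line_adj eq_sym finset.setIC. Qed.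

Fact line_adj_irrefl (G : sgraph) : irreflexive (@line_adj G).
Proof. by move=> e; rewrite /line_adj eqxx. Qed.

Definition line_graph (G : sgraph) : sgraph :=
  SGraph (@line_adj_sym G) (@line_adj_irrefl G).

Definition dist_edge_colorable (t : nat) (G : sgraph) (k : nat) : bool :=
  [exists c : {ffun line_graph G -> 'I_k},
    [forall e : line_graph G, forall f : line_graph G,
      (e != f) && ext_leq (distance e f) (Some t) ==> (c e != c f)]].

Fact dist_edge_colorable_ex (t : nat) (G : sgraph) :
  exists k, dist_edge_colorable t G k.
Proof.
exists #|line_graph G|; apply/existsP; exists [ffun e => enum_rank e].
apply/forallP => e; apply/forallP => f; apply/implyP => /andP[ef _].
by rewrite !ffunE (inj_eq enum_rank_inj).
Qed.

Definition dist_chromatic_index (t : nat) (G : sgraph) : nat :=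
  ex_minn (dist_edge_colorable_ex t G).

Local Open Scope classical_set_scope.
Local Open Scope ring_scope.

(* A drawing in the plane: distinct vertices are distinct points, each edge is
   a simple (continuous, injective) arc joining the points of its two
   endpoints, and the interior of an arc contains no vertex and no point of the
   interior of another arc. *)
Definition planar (R : realType) (G : sgraph) : Prop :=
  exists (pos : G -> R * R) (arc : edge G -> R -> R * R),
    [/\ injective pos,
        forall e : edge G, {within `[0, 1], continuous (arc e)}
          /\ {in `[0, 1] &, injective (arc e)},
        forall e : edge G,
          [set arc e 0; arc e 1] = [set pos x | x in [set` val e]],
        forall (e : edge G) (s : R) (x : G), s \in `]0, 1[ ->
          arc e s <> pos x
      & forall (e f : edge G) (r s : R), e != f ->
          r \in `]0, 1[ -> s \in `]0, 1[ -> arc e r <> arc f s].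

Definition tau (R : realType) (t d : nat) : R :=
  (d%:R - 2)^-1 * (d%:R * (d%:R - 1) ^+ (t.+1)./2 - d%:R).

(* Main.v *)
Require Import Defs.
From mathcomp Require Import all_boot zify.

(** Write [t = 2 k - 1] and [D = d - 1]; then [tau] is the number
    [K = d (1 + D + ... + D ^ (k - 1))] of edges in the ball of radius [k] of
    the [d]-regular tree.

    Colouring.  Induct on the number of edges.  Peel off pendant trees until a
    core is left in which no vertex has degree 1.  If some vertex lies at depth
    at least [k] in its tree, delete a deepest leaf: the edges that conflict
    with the leaf edge all lie in the ball of radius [k] around the ancestor at
    distance [k], so at most [K - 1] colours are forbidden.  The same works in
    a component whose core is a single vertex.  Otherwise all trees have depth
    less than [k], and it suffices that some core vertex [u] is far from all
    core vertices of degree other than 2: delete a core edge at [u], colour the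
    rest, uncolour the edges close to it, and colour them again one by one.
    Each of them conflicts only with edges meeting the ball of radius [2 k - 2]
    around an edge of a long thread of the core, and for [d >= 2 k + 1] there
    are at most [K] of those.

    Existence of the thread.  If no vertex of the core is far from the vertices
    of degree at least 3, the core has too many edges for its girth: a planar
    graph with [n] vertices, [m] edges and girth [g] has [m <= n + f] for some
    family of [f] faces with [g f <= 2 m].

    Planarity.  The only topological input is that a planar graph is a minor of
    a square grid.  Cut every arc into thirds.  The end thirds at a vertex form
    a compact connected set, disjoint from those of the other vertices and from
    all middle thirds of the edges not at this vertex, so for a fine grid the
    grid points close to these sets give the branch sets and the connections.
    In the grid, every cycle is the boundary of a set of squares.  The faces of
    the minor are the classes of squares that are linked without crossing it;
    modulo 2, cycles are exactly sums of boundaries of faces, which gives the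
    count above. *)

Set Implicit Arguments.
Unset Strict Implicit.
Unset Printing Implicit Defensive.

(** * Walks of bounded length *)

Section Walks.
Variables (V : finType) (h : rel V).

(** Walks of at most [n] steps: this is monotone in [n], so it serves directly as a ball around
    [x]. *)
Fixpoint walk_le n x y : bool :=
  if n is m.+1 then (x == y) || [exists z, h x z && walk_le m z y] else x == y.

Lemma walk_le_refl n x : walk_le n x x.
Proof. by case: n => [|n] /=; rewrite eqxx. Qed.

Lemma walk_le_step n x z y : h x z -> walk_le n z y -> walk_le n.+1 x y.
Proof. by move=> hxz wzy /=; apply/orP; right; apply/existsP; exists z; rewrite hxz. Qed.

Lemma walk_leSP n x y :
  walk_le n.+1 x y -> x = y \/ exists2 z, h x z & walk_le n z y.
Proof.
by case/orP => [/eqP|/existsP[z /andP[]]]; [left | right; exists z].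
Qed.

Lemma walk_leS n x y : walk_le n x y -> walk_le n.+1 x y.
Proof.
elim: n x => [|n IHn] x; first by move=> /eqP->; apply: walk_le_refl.
move=> /walk_leSP[->|[z hxz wzy]]; first exact: walk_le_refl.
exact: walk_le_step hxz (IHn _ wzy).
Qed.

Lemma walk_le_mono m n x y : m <= n -> walk_le m x y -> walk_le n x y.
Proof.
move=> /subnKC <-; elim: (n - m) => [|p IHp]; first by rewrite addn0.
by rewrite addnS => /IHp; apply: walk_leS.
Qed.

Lemma walk_le_trans m n x y z :
  walk_le m x y -> walk_le n y z -> walk_le (m + n) x z.
Proof.
elim: m x => [|m IHm] x; first by move=> /eqP->.
move=> /walk_leSP[->|[u hxu wuy]] wyz; last exact: walk_le_step hxu (IHm _ wuy wyz).
by apply: walk_le_mono wyz; apply: leq_addl.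
Qed.

Lemma walk_le1 x y : h x y -> walk_le 1 x y.
Proof. by move=> hxy; apply: walk_le_step hxy (walk_le_refl _ _). Qed.

Lemma walk_le_stepr n x y z : walk_le n x y -> h y z -> walk_le n.+1 x z.
Proof. by move=> wxy hyz; rewrite -addn1; apply: walk_le_trans wxy (walk_le1 hyz). Qed.

Hypothesis h_sym : symmetric h.

Lemma walk_le_sym n x y : walk_le n x y -> walk_le n y x.
Proof.
elim: n x => [|n IHn] x; first by rewrite /= eq_sym.
move=> /walk_leSP[->|[z hxz wzy]]; first exact: walk_le_refl.
by apply: walk_le_stepr (IHn _ wzy) _; rewrite h_sym.
Qed.

Lemma walk_leSPr n x y :
  walk_le n.+1 x y -> walk_le n x y \/ exists2 z, h z y & walk_le n x z.
Proof.
move=> /walk_le_sym /walk_leSP[->|[z hyz wzx]]; first by left; apply: walk_le_refl.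
by right; exists z; [rewrite h_sym | apply: walk_le_sym].
Qed.

End Walks.

(** The elements of [U] are coloured one at a time, in any order; each new one is in conflict with
    fewer than [K] others, so a colour is free. *)
Lemma greedy_extension (T : finType) (conflict : rel T) (E U : {set T}) (K : nat) :
    symmetric conflict -> reflexive conflict -> U \subset E ->
    (forall e, e \in U -> #|[set f in E | conflict e f]| <= K) ->
    (exists col : T -> 'I_K, {in E :\: U &, forall e f,
       e != f -> conflict e f -> col e != col f}) ->
  exists col : T -> 'I_K, {in E &, forall e f,
       e != f -> conflict e f -> col e != col f}.
Proof.
move=> csym crefl; elim: {U}_.+1 {-2}U (ltnSn #|U|) => // n IHn U ltUn sUE degU.
case: (set_0Vmem U) => [->|[e eU]]; first by rewrite setD0.
case=> col colP; apply: (IHn (U :\ e)).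
- by move: ltUn; rewrite (cardsD1 e U) eU.
- by apply: subset_trans sUE; apply: subsetDl.
- by move=> f /setD1P[_]; apply: degU.
have eE : e \in E by apply: (subsetP sUE).
(* By reflexivity the bound [K] counts [e] itself, so [N] has fewer than [K] elements. *)
pose N := [set f in E | conflict e f] :\ e.
have ltN : #|col @: N| < K.
  apply: leq_ltn_trans (leq_imset_card _ _) _.
  apply: leq_trans (degU e eU).
  by rewrite [X in _ < X](cardsD1 e) inE eE crefl.
have /subsetPn[c _ cN] : ~~ ([set: 'I_K] \subset col @: N).
  by apply/negP => /subset_leq_card; rewrite cardsT card_ord leqNgt ltN.
exists (fun f => if f == e then c else col f) => f g.
rewrite !inE !negb_and !negbK => /andP[fU fE] /andP[gU gE] neq cfg.
have avoid v : v \in E -> v != e -> conflict e v -> c != col v.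
  move=> vE vNe cev; apply: contraNneq cN => ->.
  by apply: imset_f; rewrite !inE vNe vE.
case: (eqVneq f e) fU neq cfg => [-> _|fe fU] neq cfg.
  by rewrite eq_sym in neq; rewrite (negPf neq); apply: avoid.
case: (eqVneq g e) gU neq cfg => [-> _|ge gU] neq cfg.
  by rewrite eq_sym; apply: avoid; rewrite // csym.
by apply: colP; rewrite ?inE ?fE ?gE ?andbT //; move: fU gU; rewrite ?(negPf fe) ?(negPf ge).
Qed.

Lemma card_bigcup_leq (I T : finType) (P : pred I) (F : I -> {set T}) (b : nat) :
  (forall i, P i -> #|F i| <= b) -> #|\bigcup_(i | P i) F i| <= #|P| * b.
Proof.
move=> leF; rewrite -sum_nat_const.
apply: (@leq_trans (\sum_(i | P i) #|F i|)); last by apply: leq_sum.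
elim/big_rec2: _ => [|i n A _ IH]; first by rewrite cards0.
apply: leq_trans (leq_card_setU _ _) _.
by rewrite leq_add2l.
Qed.

(** * Edges and the number of edges in a ball *)

Section Edges.
Variables (V : finType) (h : rel V).

Definition edge_set : {set {set V}} :=
  [set A | [exists x, exists y, h x y && (A == [set x; y])]].

Lemma edge_setP A :
  reflect (exists x y, h x y /\ A = [set x; y]) (A \in edge_set).
Proof.
rewrite inE; apply: (iffP existsP) => [[x /existsP[y /andP[hxy /eqP]]]|[x [y [hxy ->]]]].
  by move=> ->; exists x, y.
by exists x; apply/existsP; exists y; rewrite hxy eqxx.
Qed.

Lemma mem_edge x y : h x y -> [set x; y] \in edge_set.
Proof. by move=> hxy; apply/edge_setP; exists x, y. Qed.

Definition nbrs x := [set y | h x y].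

Hypothesis h_sym : symmetric h.

Lemma edge_endP A x : A \in edge_set -> x \in A -> exists2 y, h x y & A = [set x; y].
Proof.
move=> /edge_setP[a [b [hab ->]]]; rewrite !inE => /orP[/eqP->|/eqP->].
  by exists b.
by exists a; rewrite 1?h_sym // setUC.
Qed.

Definition near_edges n w := [set A in edge_set | [exists x in A, walk_le h n w x]].

Section Ball.
Variables (w : V) (d : nat).
Hypothesis deg_le : forall x, #|nbrs x| <= d.

Let ball n := [set y | walk_le h n w y].
(** The index is shifted: these are the vertices at distance exactly [n.+1]. *)
Let sphere n := ball n.+1 :\: ball n.

Let inner y n : y \in sphere n -> exists2 z, h y z & z \in ball n.
Proof.
rewrite !inE => /andP[nyb] /walk_leSPr => /(_ h_sym) [wy|[z hzy wz]].
  by rewrite wy in nyb.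
by exists z; rewrite ?inE // h_sym.
Qed.

Let outer_le y n : y \in sphere n -> #|nbrs y :\: ball n| <= d.-1.
Proof.
case/inner => z hyz zb; have zn : z \in nbrs y by rewrite inE.
have := deg_le y; rewrite (cardsD1 z) zn => led.
apply: leq_trans (_ : #|nbrs y :\ z| <= _); last by lia.
apply: subset_leq_card; apply/subsetP => u; rewrite !inE => /andP[ub ->].
by rewrite andbT; apply: contraNneq ub => ->; rewrite inE in zb.
Qed.

Let sphere_le n : #|sphere n| <= d * d.-1 ^ n.
Proof.
elim: n => [|n IHn].
  rewrite muln1; apply: leq_trans (deg_le w); apply: subset_leq_card.
  apply/subsetP => y; rewrite in_setD => /andP[yn0]; rewrite inE => /walk_leSP[yw|[z hwz /eqP zy]].
    by move: yn0; rewrite inE /= yw eqxx.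
  by rewrite inE -zy.
rewrite expnSr mulnA; apply: leq_trans (_ : #|sphere n| * d.-1 <= _); last first.
  by rewrite leq_mul2r IHn orbT.
apply: leq_trans (card_bigcup_leq (P := mem (sphere n)) (@outer_le ^~ n)).
apply: subset_leq_card; apply/subsetP => y; rewrite in_setD => /andP[yb].
rewrite inE => /walk_leSPr => /(_ h_sym) [wy|[z hzy wz]]; first by rewrite inE wy in yb.
apply/bigcupP; exists z; last first.
  by rewrite in_setD 2!inE hzy andbT; apply: contraNN yb => wy; rewrite inE; apply: walk_leS.
rewrite /sphere !inE wz andbT; apply: contraNN yb => wz'.
by rewrite inE; apply: walk_le_stepr hzy.
Qed.

(** An edge that is new at radius [n.+1] starts in [sphere n] and avoids [ball n]. A vertex of the
    sphere has at most [d.-1] such edges, as one of its edges leads back in. *)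
Lemma near_edges_le n : #|near_edges n w| <= d * \sum_(i < n.+1) d.-1 ^ i.
Proof.
elim: n => [|n IHn].
  rewrite big_ord_recl big_ord0 addn0 muln1 -[X in _ <= X]mul1n.
  apply: leq_trans (_ : #|[set [set w; y] | y in nbrs w]| <= _); last first.
    by rewrite mul1n; apply: leq_trans (leq_imset_card _ _) (deg_le w).
  apply: subset_leq_card; apply/subsetP => A; rewrite inE => /andP[AE /existsP[x /andP[xA /eqP wx]]].
  have [y hxy ->] := edge_endP AE xA.
  by rewrite wx; apply/imsetP; exists y => //; rewrite inE.
rewrite big_ord_recr /= mulnDr.
apply: leq_trans (leq_add IHn (_ : #|sphere n| * d.-1 <= _)); last first.
  by rewrite expnSr mulnA leq_mul2r sphere_le orbT.
apply: leq_trans (leq_add (leqnn _) (card_bigcup_leq (P := mem (sphere n))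
   (F := fun y => [set [set y; z] | z in nbrs y :\: ball n]) _)); last first.
  by move=> y yS; apply: leq_trans (leq_imset_card _ _) (outer_le yS).
apply: leq_trans (leq_card_setU _ _); apply: subset_leq_card.
apply/subsetP => A; rewrite in_setU.
case An : (A \in near_edges n w) => //.
rewrite inE => /andP[AE /existsP[x /andP[xA wx]]] /=.
have nA u : u \in A -> u \notin ball n.
  move=> uA; apply: contraFN An; rewrite !inE => wu; apply/andP; split.
    by move: AE; rewrite inE.
  by apply/existsP; exists u; rewrite uA.
have [y hxy EA] := edge_endP AE xA.
apply/bigcupP; exists x; first by rewrite inE nA // inE.
by rewrite EA; apply: imset_f; rewrite in_setD nA ?EA ?inE ?eqxx ?orbT.
Qed.

End Ball.
End Edges.

(** * Walking through vertices of degree 2 *)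

Section TwoNeighbours.
Variables (V : finType) (c : rel V).

(** How a walk that enters [x] from [p] continues without turning back. The default [x] does not
    arise when [p] is one of exactly two neighbours of [x]. *)
Definition other p x := odflt x [pick z | c x z && (z != p)].
Definition advance (q : V * V) := (q.2, other q.1 q.2).

Lemma two_nbrs p x : symmetric c -> #|nbrs c x| = 2 -> c p x ->
  c x (other p x) /\ forall z, c x z -> z = p \/ z = other p x.
Proof.
move=> cs x2 hpx; have px : p \in nbrs c x by rewrite inE cs.
have : #|nbrs c x :\ p| = 1 by have := x2; rewrite (cardsD1 p) px; lia.
move=> /eqP/cards1P[q Eq].
have Hq z : c x z && (z != p) = (z == q).
  by have := in_set1 z q; rewrite -Eq !inE andbC.
rewrite /other; case: pickP => [z|none] /=; last by have := none q; rewrite Hq eqxx.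
move=> zE; have [hxz zp] := andP zE; split=> // u hxu.
case: (eqVneq u p) => [->|up]; first by left.
right; rewrite Hq in zE; rewrite (eqP zE).
by apply/eqP; rewrite -Hq hxu up.
Qed.

End TwoNeighbours.

(** * Conflicting edges and recolouring *)

Section Conflict.
Variables (V : finType) (h : rel V).

(** For distinct edges this means distance at most [n.+1] in the line graph, hence [n] will be
    [t.-1]. Equality is included to make the relation reflexive. *)
Definition conflict n (A B : {set V}) :=
  (A == B) || [exists x in A, exists y in B, walk_le h n x y].

Lemma conflict_sym n : symmetric h -> symmetric (conflict n).
Proof.
move=> hs A B; rewrite /conflict eq_sym; congr (_ || _).
by apply/exists_inP/exists_inP => -[x xA /exists_inP[y yB wxy]];
  exists y => //; apply/exists_inP; exists x => //; apply: walk_le_sym.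
Qed.

Lemma conflict_refl n : reflexive (conflict n).
Proof. by move=> A; rewrite /conflict eqxx. Qed.

Definition colorable n K := exists col : {set V} -> 'I_K,
  {in edge_set h &, forall A B, A != B -> conflict n A B -> col A != col B}.

End Conflict.

(** The common form of all reductions: colour a subgraph [h'], forget the colours on [U] and choose
    them again greedily. The last condition on [U] says that outside it no edge and no conflict of
    [h] is lost in [h']. *)
Lemma recolor (V : finType) (h h' : rel V) (U : {set {set V}}) n K :
    symmetric h -> subrel h' h -> U \subset edge_set h ->
    (forall A, A \in U -> #|[set B in edge_set h | conflict h n A B]| <= K) ->
    (forall A B, A \in edge_set h :\: U -> B \in edge_set h :\: U ->
      conflict h n A B -> [/\ A \in edge_set h', B \in edge_set h' & conflict h' n A B]) ->
  colorable h' n K -> colorable h n K.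
Proof.
move=> hs sub sU leU cP [col colP].
apply: (greedy_extension (conflict_sym n hs) (@conflict_refl _ h n) sU leU).
exists col => A B AE BE neq cAB.
by have [? ? ?] := cP _ _ AE BE cAB; apply: colP.
Qed.

(** * Peeling a graph to its core *)

Section Peeling.
Variables (V : finType) (h : rel V).

Definition core_rel (dp : V -> nat) : rel V :=
  fun x y => [&& h x y, dp x == 0 & dp y == 0].

Definition rooted_at (dp : V -> nat) (par : V -> V) x := iter (dp x) par x.

(** Trees hung on a core: [dp] is the depth below the core, 0 on the core itself, and [par] is the
    parent. *)
Definition peeling (dp : V -> nat) (par : V -> V) :=
  (forall x, 0 < dp x -> h x (par x) /\ (dp (par x)).+1 = dp x) /\
  (forall x y, h x y -> [\/ dp x = 0 /\ dp y = 0,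
     dp y = (dp x).+1 /\ par y = x | dp x = (dp y).+1 /\ par x = y]).

Lemma root_par dp par x : peeling dp par -> 0 < dp x ->
  rooted_at dp par (par x) = rooted_at dp par x.
Proof.
by case=> P1 _ dx; have [_ E] := P1 x dx; rewrite /rooted_at -E iterSr.
Qed.

Lemma root_core dp par x : peeling dp par -> dp (rooted_at dp par x) = 0.
Proof.
move=> P; have [P1 _] := P; elim: {x}(dp x) {-2}x (erefl (dp x)) => [|n IHn] x E.
  by rewrite /rooted_at E.
have dx : 0 < dp x by rewrite E.
rewrite -root_par //; apply: IHn; have [_] := P1 x dx; lia.
Qed.

Lemma root0 dp par x : dp x = 0 -> rooted_at dp par x = x.
Proof. by rewrite /rooted_at => ->. Qed.

(** Start with every vertex in the core. While some core vertex has exactly one core neighbour, hang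
    it with its tree below that neighbour; the number of vertices of depth 0 drops. *)
Lemma peeling_exists : symmetric h -> irreflexive h ->
  exists dp par, peeling dp par /\
    forall x, dp x = 0 -> #|nbrs (core_rel dp) x| != 1.
Proof.
move=> hs hi.
suff H n dp par : #|[set x | dp x == 0]| < n -> peeling dp par ->
    exists dp par, peeling dp par /\ forall x, dp x = 0 -> #|nbrs (core_rel dp) x| != 1.
  by apply: (H _ (fun=> 0) id (ltnSn _)); split=> // x y hxy; constructor 1.
elim: n dp par => // n IHn dp par ltn P.
case: (boolP [exists x, (dp x == 0) && (#|nbrs (core_rel dp) x| == 1)]); last first.
  move=> /existsPn H; exists dp, par; split=> // x dx0; have := H x.
  by rewrite dx0 eqxx.
case/existsP=> v /andP[/eqP dv /cards1P[p Ep]].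
have [hvp dp0] : h v p /\ dp p = 0.
  by have : p \in nbrs (core_rel dp) v; [rewrite Ep inE | rewrite inE => /and3P[? _ /eqP]].
have uniq_p y : h v y -> dp y = 0 -> y = p.
  move=> hvy dy; apply/eqP; have : y \in nbrs (core_rel dp) v by rewrite inE /core_rel hvy dv dy eqxx.
  by rewrite Ep inE.
(* The whole tree rooted at [v] sinks by one level, and [v] becomes a child of [p]. *)
pose rt := rooted_at dp par.
pose dp' x := dp x + (rt x == v); pose par' x := if x == v then p else par x.
have rtv : rt v = v by apply: root0.
have pv : p != v by apply: contraTneq hvp => ->; rewrite hi.
apply: (IHn dp' par').
- apply: leq_trans (_ : #|[set x | dp x == 0]| <= _); last by lia.
  apply: proper_card; apply/properP; split.
    by apply/subsetP => x; rewrite !inE /dp'; lia.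
  by exists v; rewrite !inE /dp' ?dv ?rtv ?eqxx.
have [P1 P2] := P; split.
  move=> x; rewrite /par' /dp'; case: (eqVneq x v) => [-> _|xv].
    by rewrite rtv eqxx dv /rt root0 // (negPf pv) dp0.
  move=> dx; have dx0 : 0 < dp x.
    by rewrite lt0n; apply: contraNneq xv => dx0; move: dx; rewrite dx0 /rt root0 //; case: eqP.
  have [-> E] := P1 x dx0; split=> //; rewrite /rt root_par //; lia.
move=> x y hxy; rewrite /par' /dp'.
have step a b : h a b -> dp b = (dp a).+1 -> par b = a ->
    dp b + (rt b == v) = (dp a + (rt a == v)).+1 /\ (if b == v then p else par b) = a.
  move=> hab db pb; have -> : (b == v) = false by apply/eqP => bv; rewrite bv dv in db.
  by split=> //; rewrite -(_ : rt a = rt b) ?db // /rt -pb root_par // db.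
case: (P2 x y hxy) => [[dx dy]|[dy py]|[dx px]].
- rewrite /rt !root0 // dx dy.
  case: (eqVneq x v) hxy => [->|xv] hxy.
    by have -> := uniq_p y hxy dy; rewrite (negPf pv); constructor 3.
  case: (eqVneq y v) hxy => [->|yv] hxy; last by constructor 1.
  by rewrite hs in hxy; rewrite (uniq_p x hxy dx); constructor 2.
- by constructor 2; apply: step.
- by constructor 3; apply: step; rewrite // hs.
Qed.
End Peeling.

(** * Removing a leaf *)

Section LeafRemoval.
Variables (V : finType) (h : rel V) (v p : V) (n K : nat).
Hypotheses (h_sym : symmetric h) (hvp : h v p).
Hypothesis (leaf : forall y, h v y -> y = p).

Definition del_vertex : rel V := fun x y => [&& h x y, x != v & y != v].

(** A walk through the leaf enters it from [p] and returns to [p] at once; cutting out this detour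
    saves two steps. *)
Let walk_le_del m x y : walk_le h m x y -> x != v -> y != v -> walk_le del_vertex m x y.
Proof.
elim: {m}_.+1 {-2}m (ltnSn m) x => // m IHm [|j] ltj x wxy xv yv //.
case/walk_leSP: wxy => [->|[z hxz wzy]]; first exact: walk_le_refl.
case: (eqVneq z v) => [zv|zv]; last first.
  apply: (@walk_le_step _ _ _ _ z); first by rewrite /del_vertex hxz xv. by apply: IHm.
case: j ltj wzy => [|j] ltj; first by rewrite zv /= eq_sym (negPf yv).
have xp : x = p by apply: leaf; rewrite -zv h_sym.
case/walk_leSP => [zy|[u hzu wuy]]; first by rewrite -zy zv eqxx in yv.
have ux : u = x by rewrite xp; apply: leaf; rewrite -zv.
apply: (@walk_le_mono _ _ j); first by lia.
by rewrite ux in wuy; apply: IHm => //; lia.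
Qed.

Lemma colorable_leaf :
    #|[set B in edge_set h | conflict h n [set v; p] B]| <= K ->
  colorable del_vertex n K -> colorable h n K.
Proof.
move=> leK; have sub : subrel del_vertex h by move=> x y /and3P[].
apply: (@recolor _ _ _ [set [set v; p]]) => //.
- by rewrite sub1set mem_edge.
- by move=> A; rewrite inE => /eqP->.
have notv A : A \in edge_set h :\: [set [set v; p]] -> v \notin A /\ A \in edge_set del_vertex.
  move=> /setDP[AE]; rewrite inE => Avp.
  have vA : v \notin A.
    by apply: contraNN Avp => vA; have [y /leaf -> ->] := edge_endP h_sym AE vA.
  split=> //; have /edge_setP[x [y [hxy EA]]] := AE; apply/edge_setP; exists x, y.
  split=> //; rewrite /del_vertex hxy /=.
  by apply/andP; split; apply: contraNneq vA => <-; rewrite EA !inE eqxx ?orbT.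
move=> A B /notv[vA AE] /notv[vB BE] /orP[/eqP->|/existsP[x /andP[xA]/existsP[y/andP[yB wxy]]]].
  by split=> //; apply: conflict_refl.
split=> //; apply/orP; right; apply/existsP; exists x; rewrite xA; apply/existsP; exists y.
rewrite yB walk_le_del //; [by apply: contraNneq vA => <- | by apply: contraNneq vB => <-].
Qed.

End LeafRemoval.

(** * Walks in pendant trees *)

Section Trees.
Variables (V : finType) (h : rel V) (dp : V -> nat) (par : V -> V).
Hypotheses (h_sym : symmetric h) (P : peeling h dp par).

Local Notation root := (rooted_at dp par).
Local Notation hc := (core_rel h dp).

(** [x] lies in the subtree hanging from [w]; the inequality guards the truncated subtraction. *)
Definition below w x := (dp w <= dp x) && (iter (dp x - dp w) par x == w).

Lemma below_refl w : below w w.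
Proof. by rewrite /below leqnn subnn /=. Qed.

Lemma below_child w x y : below w x -> dp y = (dp x).+1 -> par y = x -> below w y.
Proof.
move=> /andP[le_wx /eqP E] dy py; rewrite /below dy subSn // iterSr py E eqxx andbT.
exact: leqW.
Qed.

Lemma below_par w x y : below w x -> x != w -> dp x = (dp y).+1 -> par x = y -> below w y.
Proof.
move=> /andP[le_wx /eqP E] xw dx px; rewrite /below.
have lt : dp w < dp x.
  rewrite ltn_neqAle le_wx andbT; apply: contra xw => /eqP dwx.
  by rewrite -dwx subnn in E; rewrite -[x]/(iter 0 par x) E.
rewrite dx ltnS in lt; rewrite lt; move: E.
by rewrite dx subSn // iterSr px => ->; rewrite eqxx.
Qed.

Lemma below_root x : below (root x) x.
Proof. by rewrite /below (root_core _ P) subn0 eqxx. Qed.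

Lemma walk_le_below w y : below w y -> walk_le h (dp y - dp w) w y.
Proof.
have [P1 _] := P; elim: {y}(dp y) {-2}y (erefl (dp y)) => [|m IHm] y dy.
  by move=> /andP[_]; rewrite dy sub0n => /eqP <-; apply: walk_le_refl.
case: (eqVneq y w) => [->|yw] b; first exact: walk_le_refl.
have [hy py] : h y (par y) /\ (dp (par y)).+1 = dp y by apply: P1; rewrite dy.
have bp : below w (par y) by apply: below_par b yw _ _.
rewrite -py subSn; last by case/andP: bp.
by apply: walk_le_stepr (IHm _ _ bp) _; [lia | rewrite h_sym].
Qed.

(** A subtree can be left only through its top [w], and climbing there from [x] costs [dp x - dp w]
    steps. *)
Lemma walk_le_leave m w x y : below w x -> walk_le h m x y ->
  below w y \/ exists2 q, q + (dp x - dp w) <= m & walk_le h q w y.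
Proof.
move=> b; elim: m x b => [|m IHm] x b.
  by move=> /eqP <-; left.
case: (eqVneq x w) => [-> wwy|xw].
  by right; exists m.+1 => //; rewrite subnn addn0.
case/walk_leSP => [<-|[z hxz wzy]]; first by left.
have [_ /(_ _ _ hxz) [[dx dz]|[dz pz]|[dx px]]] := P.
- case/andP: b; rewrite dx leqn0 sub0n /= => _ /eqP xw'; by rewrite xw' eqxx in xw.
- have bz := below_child b dz pz; case: (IHm _ bz wzy) => [|[q leq wq]]; first by left.
  by right; exists q => //; case/andP: b; lia.
- have bz := below_par b xw dx px; case: (IHm _ bz wzy) => [|[q leq wq]]; first by left.
  by right; exists q => //; lia.
Qed.

(** Without core neighbours of [w], its tree is a whole component. *)
Lemma walk_le_isolated m w y : dp w = 0 -> nbrs hc w = set0 -> walk_le h m w y -> below w y.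
Proof.
move=> dw iso.
suff H x : below w x -> walk_le h m x y -> below w y by apply: H; apply: below_refl.
elim: m x => [|m IHm] x b; first by move=> /eqP<-.
case/walk_leSP => [<-//|[z hxz]]; apply: IHm.
have [_ /(_ _ _ hxz) [[dx dz]|[dz pz]|[dx px]]] := P.
- have xw : x = w by case/andP: b; rewrite dx => _ /eqP.
  have : z \in nbrs hc w by rewrite inE /core_rel -xw hxz dx dz.
  by rewrite iso inE.
- exact: below_child b dz pz.
- have xw : x != w by apply/eqP => xw; rewrite xw dw in dx.
  exact: below_par b xw dx px.
Qed.

(* The walk is projected to the core along the trees. *)
Lemma walk_le_core m x y : dp x = 0 -> walk_le h m x y ->
  exists2 o, o + dp y <= m & walk_le hc o x (root y).
Proof.
move=> dx; elim: m y => [|m IHm] y.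
  by move=> /eqP<-; exists 0; rewrite ?dx //= root0.
case/walk_leSPr => // [wxy|[z hzy wxz]].
  by have [o ? ?] := IHm y wxy; exists o => //; lia.
have [o leo wo] := IHm z wxz.
have [_ /(_ _ _ hzy) [[dz dy]|[dy py]|[dz pz]]] := P.
- exists o.+1; first by lia.
  rewrite !root0 // in wo *; apply: walk_le_stepr wo _.
  by rewrite /core_rel hzy dz dy.
- exists o; first by lia.
  by rewrite -(root_par P) ?py // dy.
- exists o; first by lia.
  by rewrite -pz (root_par P) // dz.
Qed.

Section Leaf.
Variables (k d : nat) (w v : V).
Hypothesis deg_le : forall x, #|nbrs h x| <= d.
Hypothesis bwv : below w v.
Hypothesis dwv : dp w < dp v.
Hypothesis dvk : dp v - dp w <= k.
Hypothesis deepest : forall y, below w y -> dp y <= dp v.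
Hypothesis alt : dp v - dp w = k \/ dp w = 0 /\ nbrs hc w = set0.

Let bottom y z : below w y -> dp y = dp v -> h y z -> z = par y.
Proof.
move=> b dy hyz.
have [_ /(_ _ _ hyz) [[dx dz]|[dz pz]|[dx px]]] := P => //; first by lia.
by have := deepest (below_child b dz pz); lia.
Qed.

(** Every such edge has an endpoint within [k.-1] of [w], so the ball count applies. Inside the
    subtree this holds because an edge at the bottom level has its upper end one level higher. A
    walk that leaves the subtree has spent at least [k.-1] of its [k.-1.*2] steps on the climb to
    [w]; if [w] is the whole core of its component, no walk leaves. *)
Lemma leaf_conflicts_le :
  #|[set B in edge_set h | conflict h k.-1.*2 [set v; par v] B]|
    <= d * \sum_(i < k) d.-1 ^ i.
Proof.
have [P1 _] := P.
have [hpv dpv] : h v (par v) /\ (dp (par v)).+1 = dp v by apply: P1; lia.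
have vw : v != w by apply/eqP => vw; have := dwv; rewrite vw ltnn.
have bpv : below w (par v) by apply: below_par bwv vw _ _.
have -> : k = k.-1.+1 by move: (dvk) (dwv); clear; lia.
apply: leq_trans (near_edges_le h_sym w deg_le k.-1).
apply: subset_leq_card; apply/subsetP => B; rewrite inE => /andP[BE cB]; rewrite inE BE /=.
have [x xv [y yB wxy]] : exists2 x, x \in [set v; par v] & exists2 y, y \in B & walk_le h k.-1.*2 x y.
  case/orP: cB => [/eqP<-|/exists_inP[x xv /exists_inP[y yB wxy]]].
    by exists v; rewrite ?inE ?eqxx //; exists v; rewrite ?inE ?eqxx // walk_le_refl.
  by exists x => //; exists y.
have [bx dx] : below w x /\ dp v <= (dp x).+1.
  by move: xv; rewrite !inE => /orP[]/eqP->; split=> //; rewrite dpv.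
have main : below w y -> exists2 z, z \in B & walk_le h k.-1 w z.
  move=> by_; have dyv := deepest by_; case: (eqVneq (dp y) (dp v)) => dy; last first.
    exists y => //; apply: walk_le_mono (walk_le_below by_).
    by move: dy dyv (dvk) (dwv); clear; lia.
  have [z hyz EB] : exists2 z, h y z & B = [set y; z].
    by have [z hyz EB] := edge_endP h_sym BE yB; exists z.
  exists z; first by rewrite EB !inE eqxx orbT.
  have Ez := bottom by_ dy hyz.
  have yw : y != w by apply/eqP => yw; have := dwv; rewrite -dy yw ltnn.
  have [_ dpy] : h y (par y) /\ (dp (par y)).+1 = dp y by apply: P1; rewrite dy (leq_ltn_trans _ dwv).
  have bz : below w z by rewrite Ez; apply: below_par by_ yw _ _.
  apply: walk_le_mono (walk_le_below bz).
  by rewrite Ez; move: dy dpy (dvk) (dwv); clear; lia.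
suff [z zB wz] : exists2 z, z \in B & walk_le h k.-1 w z.
  by apply/exists_inP; exists z.
case: (walk_le_leave bx wxy) => [/main //|[q leq wq]].
case: alt => [dk|[dw iso]]; last by apply: main; apply: walk_le_isolated wq.
exists y => //; apply: walk_le_mono wq.
by move: leq dx dk; rewrite -addnn; clear; lia.
Qed.

End Leaf.
End Trees.

(** * Balls around a thread *)

Section Numeric.

Lemma geometric_step (D n : nat) :
  D * \sum_(i < n) D ^ i + 1 = \sum_(i < n) D ^ i + D ^ n.
Proof.
transitivity (\sum_(i < n.+1) D ^ i); last by rewrite big_ord_recr.
rewrite big_ord_recl /= expn0 addnC.
by congr (_ + _); rewrite big_distrr /=; apply: eq_bigr => i _; rewrite expnS.
Qed.

(* For [d = k.*2.+1] this is an equality, whence the hypothesis on the maximum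
   degree. *)
Lemma thread_count (k d : nat) : 0 < k -> k.*2 < d ->
  1 + \sum_(i < k.*2.-1) (d.-1 ^ minn k.-1 (k.*2.-1 - i)).*2
    <= d * \sum_(i < k) d.-1 ^ i.
Proof.
move=> k0 ltd; set D := d.-1; have dE : d = D.+1 by rewrite /D; lia.
rewrite (reindex_inj rev_ord_inj) /=.
(* Read from the far end, the exponents are [1, ..., k.-1], followed by [k] terms with exponent
   [k.-1]. *)
have -> : \sum_(i < k.*2.-1) (D ^ minn k.-1 (k.*2.-1 - (k.*2.-1 - i.+1))).*2 =
    (\sum_(0 <= i < k.*2.-1) D ^ minn k.-1 i.+1).*2.
  rewrite -[RHS]muln2 big_distrl /= big_mkord; apply: eq_bigr => i _.
  by rewrite muln2 subKn.
rewrite (@big_cat_nat _ _ _ k.-1) /=; [ | by [] | by lia].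
have -> : \sum_(0 <= i < k.-1) D ^ minn k.-1 i.+1 = D * \sum_(i < k.-1) D ^ i.
  rewrite big_distrr /= big_mkord; apply: eq_bigr => i _.
  by rewrite (minn_idPr (ltn_ord i)) expnS.
have -> : \sum_(k.-1 <= i < k.*2.-1) D ^ minn k.-1 i.+1 = k * D ^ k.-1.
  rewrite (eq_big_nat _ _ (F2 := fun=> D ^ k.-1)).
    by rewrite sum_nat_const_nat; congr (_ * _); lia.
  by move=> i /andP[lei _]; rewrite (minn_idPl _) // leqW.
have G1 := geometric_step D k.-1; have G2 := geometric_step D k.
have S : \sum_(i < k) D ^ i = \sum_(i < k.-1) D ^ i + D ^ k.-1.
  by clear -k0; case: k k0 => // k _; rewrite big_ord_recr.
have pw : k.*2 * D ^ k.-1 <= D ^ k.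
  by rewrite -[X in _ <= D ^ X](prednK k0) expnS leq_mul2r; lia.
rewrite dE mulSn; move: G1 G2 S pw; rewrite -!muln2.
move: (\sum_(i < k.-1) _) (\sum_(i < k) _) (D ^ k.-1) (D ^ k) => g g' e e'.
by clear; nia.
Qed.

End Numeric.

Section Thread.
Variables (V : finType) (h : rel V) (dp : V -> nat) (par : V -> V) (k d : nat).
Hypotheses (h_sym : symmetric h) (P : peeling h dp par).
Hypothesis deg_le : forall x, #|nbrs h x| <= d.
Hypothesis depth_le : forall x, dp x <= k.-1.

Local Notation root := (rooted_at dp par).
Local Notation hc := (core_rel h dp).

Lemma core_sym : symmetric hc.
Proof. by move=> x y; rewrite /core_rel h_sym; congr (_ && _); rewrite andbC. Qed.

Definition tree c m := [set z | (root z == c) && (0 < dp z <= m)].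

(** At least two neighbours of [c] are in the core, so level [j.+1] has at most [d.-2 * d.-1 ^ j]
    vertices, and these numbers sum to [d.-1 ^ m - 1]. The strict inequality leaves room for one
    core edge at [c]. *)
Lemma tree_lt c m : dp c = 0 -> 1 < #|nbrs hc c| -> #|tree c m| < d.-1 ^ m.
Proof.
have [P1 P2] := P; move=> dc nc.
have d2 : 1 < d.
  apply: leq_trans nc (leq_trans _ (deg_le c)); apply: subset_leq_card.
  by apply/subsetP => x; rewrite !inE => /and3P[].
have up x j : dp x = j.+1 -> h x (par x) /\ dp (par x) = j.
  by move=> dx; have [] := P1 x; rewrite dx // => hx [].
pose L j := [set z | (root z == c) && (dp z == j.+1)].
have L0 : #|L 0| <= d.-2.
  have : #|L 0 :|: nbrs hc c| <= d.
    apply: leq_trans (deg_le c); apply: subset_leq_card; apply/subsetP => x.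
    rewrite !inE => /orP[/andP[/eqP rx /eqP dx]|/and3P[]//].
    have [hx px] := up x 0 dx.
    by rewrite -rx -(root_par P) ?dx // root0 // h_sym.
  rewrite cardsU; have -> : L 0 :&: nbrs hc c = set0.
    by apply/setP => x; rewrite !inE; apply/negP => /andP[/andP[_ /eqP dx] /and3P[_ _]]; rewrite dx.
  by rewrite cards0; lia.
have LS j : #|L j.+1| <= #|L j| * d.-1.
  apply: leq_trans (card_bigcup_leq (P := mem (L j)) (F := fun x => nbrs h x :\ par x) _).
    apply: subset_leq_card; apply/subsetP => z; rewrite inE => /andP[/eqP rz /eqP dz].
    have [hz dpz] := up z _ dz.
    apply/bigcupP; exists (par z).
      by rewrite !inE (root_par P) ?rz ?dz // dpz !eqxx.
    have [_ pp] := up (par z) j dpz.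
    rewrite !inE h_sym hz andbT; apply/eqP => E.
    by rewrite -E dz in pp; lia.
  move=> x; rewrite !inE => /andP[_ /eqP dx].
  have [hx _] := up x _ dx.
  by have := deg_le x; rewrite (cardsD1 (par x)) inE hx //; lia.
have Lle j : #|L j| <= d.-2 * d.-1 ^ j.
  elim: j => [|j IHj]; first by rewrite muln1.
  by apply: leq_trans (LS j) _; rewrite expnSr mulnA leq_mul2r IHj orbT.
elim: m => [|m IHm].
  rewrite (_ : tree c 0 = set0) ?cards0 //; apply/setP => z; rewrite !inE.
  by case: (dp z) => [|?]; rewrite andbF.
have sub : #|tree c m.+1| <= #|tree c m| + #|L m|.
  apply: leq_trans (leq_card_setU _ _); apply: subset_leq_card; apply/subsetP => z.
  by rewrite !inE => /andP[->] /=; lia.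
apply: leq_ltn_trans sub _; rewrite expnS; have := Lle m.
have E : d.-1 = d.-2.+1 by lia.
move: IHm; move: (d.-1 ^ m) => e IHm leL; rewrite E mulSn.
by move: IHm leL; move: (d.-2 * e) #|tree c m| #|L m|; clear; lia.
Qed.

Variable N : nat.

Local Notation advance := (advance hc).
(** The walk that starts at [a] and heads away from [b]; the second component is the vertex reached
    after [i] steps. *)
Definition track a b i := iter i advance (b, a).

Section Track.
Variables a b : V.
Hypothesis good : forall y, walk_le hc N a y -> #|nbrs hc y| = 2.
Hypothesis hba : hc b a.

Lemma trackP i : i <= N ->
  hc (track a b i).1 (track a b i).2 /\ walk_le hc i a (track a b i).2.
Proof.
elim: i => [|i IHi] lei; first by split=> //=.
have [hi wi] := IHi (ltnW lei).
have [ho _] := two_nbrs core_sym (good (walk_le_mono (ltnW lei) wi)) hi.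
by split=> //=; apply: walk_le_stepr wi ho.
Qed.

Lemma track_nbr i z : i <= N -> hc (track a b i).2 z ->
  z = (track a b i.+1).2 \/
  (if i is j.+1 then z = (track a b j).2 else z = b).
Proof.
move=> lei hz; have [hi wi] := trackP lei.
have [_ /(_ z hz)[]] := two_nbrs core_sym (good (walk_le_mono lei wi)) hi; last by left.
by case: (i) => [|j] ->; right.
Qed.

End Track.

(** The edges charged to the [i]-th vertex of a track: the core edge ahead, and the tree edges down
    to depth [N.+1 - i], whose upper ends are within [N] of [a]. *)
Definition track_edges a b i : {set {set V}} :=
  [set (track a b i).2; (track a b i.+1).2] |:
  [set [set z; par z] | z in tree (track a b i).2 (minn k.-1 (N.+1 - i))].

Lemma track_edges_le a b i : (forall y, walk_le hc N a y -> #|nbrs hc y| = 2) ->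
  hc b a -> i <= N -> #|track_edges a b i| <= d.-1 ^ minn k.-1 (N.+1 - i).
Proof.
move=> good hba lei; have [/and3P[_ _ /eqP dc] wi] := trackP good hba lei.
apply: leq_trans (leq_card_setU _ _) _; rewrite cards1 add1n.
apply: leq_ltn_trans (leq_imset_card _ _) _.
by apply: tree_lt => //; rewrite (good _ (walk_le_mono lei wi)).
Qed.

(** All core vertices in reach have degree 2, so the core seen from [ab] consists of two tracks
    leaving in opposite directions. Every edge in reach is [ab] or is charged to a vertex of a
    track. *)
Lemma near_core_edge_le a b : hc a b ->
    (forall y, walk_le hc N a y || walk_le hc N b y -> #|nbrs hc y| = 2) ->
  #|[set B in edge_set h | [exists x in B, walk_le h N a x || walk_le h N b x]]|
    <= 1 + \sum_(i < N.+1) (d.-1 ^ minn k.-1 (N.+1 - i)).*2.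
Proof.
move=> hab good.
have hba : hc b a by rewrite core_sym.
have goodA y : walk_le hc N a y -> #|nbrs hc y| = 2 by move=> w; apply: good; rewrite w.
have goodB y : walk_le hc N b y -> #|nbrs hc y| = 2.
  by move=> w; apply: good; rewrite w orbT.
have [_ P2] := P; have /and3P[_ /eqP da /eqP db] := hab.
pose cover := [set [set a; b]] :|: \bigcup_(i < N.+1) (track_edges a b i :|: track_edges b a i).
apply: (@leq_trans #|cover|); last first.
  apply: leq_trans (leq_card_setU _ _) _; rewrite cards1 leq_add2l.
  apply: (@leq_trans (\sum_(i < N.+1) #|track_edges a b i :|: track_edges b a i|)).
    elim/big_rec2: _ => [|i n A _ IH]; first by rewrite cards0.
    by apply: leq_trans (leq_card_setU _ _) _; rewrite leq_add2l.
  apply: leq_sum => i _; apply: leq_trans (leq_card_setU _ _) _.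
  by rewrite -addnn leq_add // track_edges_le // -ltnS.
(* A core step from a track vertex goes ahead or back; going back from the start of one track leads
   to the start of the other. *)
have seen n y : n <= N -> walk_le hc n a y || walk_le hc n b y ->
    exists2 i, i <= n & y = (track a b i).2 \/ y = (track b a i).2.
  elim: n y => [|n IHn] y len.
    by case/orP => /eqP <-; exists 0 => //; [left | right].
  have IH : walk_le hc n a y || walk_le hc n b y ->
      exists2 i, i <= n.+1 & y = (track a b i).2 \/ y = (track b a i).2.
    by move/(IHn y (ltnW len)) => [i lei E]; exists i => //; apply: leqW.
  have ext z : hc z y -> walk_le hc n a z || walk_le hc n b z ->
      exists2 i, i <= n.+1 & y = (track a b i).2 \/ y = (track b a i).2.
    move=> hzy /(IHn z (ltnW len)) [i lei E].
    have leiN : i <= N by apply: leq_trans lei (ltnW len).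
    case: E hzy => -> hzy.
      case: (track_nbr goodA hba leiN hzy) => [E|]; first by exists i.+1; rewrite ?ltnS //; left.
      by case: i lei {leiN hzy} => [|j] lej E; [exists 0; rewrite // E; right | exists j; [lia | left]].
    case: (track_nbr goodB hab leiN hzy) => [E|]; first by exists i.+1; rewrite ?ltnS //; right.
    by case: i lei {leiN hzy} => [|j] lej E; [exists 0; rewrite // E; left | exists j; [lia | right]].
  case/orP => /walk_leSPr => /(_ core_sym) [w|[z hzy w]].
  - by apply: IH; rewrite w.
  - by apply: (ext z) => //; rewrite w.
  - by apply: IH; rewrite w orbT.
  - by apply: (ext z) => //; rewrite w orbT.
apply: subset_leq_card; apply/subsetP => B; rewrite inE => /andP[BE /exists_inP[x xB wx]].
have [o leo wo] : exists2 o, o + dp x <= N & walk_le hc o a (root x) || walk_le hc o b (root x).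
  by case/orP: wx => /(walk_le_core h_sym P) => [/(_ da)|/(_ db)] [o leo w];
    exists o => //; rewrite w ?orbT.
have [i lei Ei] := seen o (root x) (leq_trans (leq_addr _ _) leo) wo.
have leiN : i < N.+1 by move: lei leo; clear; lia.
have [x' hxx' ->] := edge_endP h_sym BE xB.
have inbig C j : C \in track_edges a b j :|: track_edges b a j -> j < N.+1 -> C \in cover.
  by move=> Cj ltj; rewrite in_setU; apply/orP; right; apply/bigcupP; exists (Ordinal ltj).
have treecase z : root z = root x -> 0 < dp z -> dp z <= N.+1 - i -> [set z; par z] \in cover.
  move=> rz dz lez; apply: (inbig _ i) => //.
  have inT c : root x = c -> z \in tree c (minn k.-1 (N.+1 - i)).
    by move=> <-; rewrite inE rz eqxx dz leq_min lez depth_le.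
  rewrite !in_setU; case: Ei => /inT zT; apply/orP; [left|right]; apply/orP; right;
    by apply/imsetP; exists z.
case: (P2 _ _ hxx') => [[dx dx']|[dx' px']|[dx px]].
- have hcx : hc x x' by rewrite /core_rel hxx' dx dx'.
  rewrite root0 // in Ei; case: Ei => Ei; rewrite Ei in hcx *.
    case: (track_nbr goodA hba (leiN : i <= N) hcx) => [->|].
      by apply: (inbig _ i) => //; rewrite !inE eqxx.
    case: i {Ei hcx lei treecase} leiN => [|j] ltj ->; first by rewrite /cover !inE eqxx.
    by apply: (inbig _ j); [rewrite setUC !inE eqxx | apply: ltnW].
  case: (track_nbr goodB hab (leiN : i <= N) hcx) => [->|].
    by apply: (inbig _ i) => //; rewrite !inE eqxx ?orbT.
  case: i {Ei hcx lei treecase} leiN => [|j] ltj ->; first by rewrite /cover setUC !inE eqxx.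
  by apply: (inbig _ j); [rewrite setUC !inE eqxx ?orbT | apply: ltnW].
- rewrite setUC -px'; apply: treecase; rewrite ?dx' //.
    by rewrite -px' (root_par P) ?dx'.
  by move: lei leo; clear; lia.
- by rewrite -px; apply: treecase; rewrite ?dx //; move: lei leo; rewrite dx; clear; lia.
Qed.

End Thread.

(** * The colouring argument *)

Section DeleteEdge.
Variables (V : finType) (h : rel V) (u0 u1 : V).

Definition del_edge : rel V := fun x y => h x y && ([set x; y] != [set u0; u1]).

(** A walk destroyed by the deletion is cut where it first uses the edge; the parts before and after
    have one step fewer in total. *)
Lemma walk_le_del_edge n x y : walk_le h n x y ->
  walk_le del_edge n x y \/ exists p q, [/\ p + q < n,
    walk_le h p x u0 || walk_le h p x u1 & walk_le h q u0 y || walk_le h q u1 y].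
Proof.
elim: n x => [|n IHn] x; first by left.
case/walk_leSP => [->|[z hxz wzy]]; first by left; apply: walk_le_refl.
case: (eqVneq [set x; z] [set u0; u1]) => [E|E].
  have xu : x \in [set u0; u1] by rewrite -E !inE eqxx.
  have zu : z \in [set u0; u1] by rewrite -E !inE eqxx orbT.
  right; exists 0, n; split; first by [].
    by move: xu; rewrite !inE /=.
  by move: zu; rewrite !inE => /orP[]/eqP <-; rewrite wzy ?orbT.
case: (IHn z wzy) => [w|[p [q [ltn wp wq]]]].
  by left; apply: walk_le_step w; rewrite /del_edge hxz.
right; exists p.+1, q; split=> //.
by case/orP: wp => /(walk_le_step hxz) ->; rewrite ?orbT.
Qed.

End DeleteEdge.

Definition far_core (V : finType) (c : rel V) (r : nat) :=
  exists2 u, nbrs c u != set0 & forall y, walk_le c r u y -> #|nbrs c y| = 2.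

(** Uncolour the set [U] of edges with an endpoint within [k - 2] of [u0] or [u1]. A walk between
    edges outside [U] that crosses the deleted edge has at least [k.-1] steps on either side and one
    across, more than [k.-1.*2]; so no conflict is lost outside [U]. The conflicts of an edge in [U]
    are bounded by [near_core_edge_le] and [thread_count]. *)
Lemma far_edge_reduction (V : finType) (h : rel V) (dp : V -> nat) (par : V -> V)
    (k d : nat) (u0 u1 : V) :
    symmetric h -> peeling h dp par ->
    (forall x, #|nbrs h x| <= d) -> 1 < k -> k.*2 < d -> (forall x, dp x <= k.-1) ->
    core_rel h dp u0 u1 ->
    (forall y, walk_le (core_rel h dp) (3 * k - 2) u0 y -> #|nbrs (core_rel h dp) y| = 2) ->
    colorable (del_edge h u0 u1) k.-1.*2 (d * \sum_(i < k) d.-1 ^ i) ->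
  colorable h k.-1.*2 (d * \sum_(i < k) d.-1 ^ i).
Proof.
move=> hs P deg k1 kd dple hu good; have [_ P2] := P.
set hc := core_rel h dp; set N := k.-1.*2.
(* The radius [3 * k - 2] allows [k.-1] steps from [u0] to [a], one to [b], and [k.-1.*2] beyond. *)
have [n2 n3 n4 n5] : [/\ k.-1.+1 + N <= 3 * k - 2, N.+1 = k.*2.-1, k.-1 <= N & 0 < k].
  by rewrite /N; move: k1; clear; split; lia.
have n1 : k.-1 + N <= 3 * k - 2 by apply: leq_trans n2; rewrite leq_add2r.
have n6 o j : o + j <= k - 2 -> o.+1 <= k.-1 by move: k1; clear; lia.
have cs : symmetric hc by apply: core_sym.
have /and3P[hu01 /eqP du0 /eqP du1] := hu.
have subc : subrel hc h by move=> x y /and3P[].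
pose U := [set A in edge_set h |
  [exists x in A, walk_le h (k - 2) u0 x || walk_le h (k - 2) u1 x]].
apply: (@recolor _ _ _ U) => //; first by move=> x y /andP[].
- by apply/subsetP => A; rewrite inE => /andP[].
- have near x : walk_le h (k - 2) u0 x || walk_le h (k - 2) u1 x ->
      walk_le hc k.-1 u0 (rooted_at dp par x).
    case/orP => [/(walk_le_core hs P du0)|/(walk_le_core hs P du1)] [o leo wo].
      by apply: walk_le_mono wo; apply/ltnW/n6/leo.
    by apply: walk_le_mono (walk_le_step hu wo); apply: n6 leo.
  move=> A; rewrite inE => /andP[AE /exists_inP[x xA wx]].
  have wrx := near x wx.
  (* For [ab] take [A] itself if it is a core edge, otherwise the root of its tree with any core
     neighbour: a walk from [A] either stays in the tree, of depth at most [k.-1], or passes the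
     root. *)
  suff [a [b [hab wa sub]]] : exists a b, [/\ hc a b, walk_le hc k.-1 u0 a &
      forall B, B \in edge_set h -> conflict h N A B ->
        [exists y in B, walk_le h N a y || walk_le h N b y]].
    have goodab y : walk_le hc N a y || walk_le hc N b y -> #|nbrs hc y| = 2.
      move=> /orP[w|w]; apply: good.
        by apply: walk_le_mono (walk_le_trans wa w).
      by apply: walk_le_mono (walk_le_trans (walk_le_stepr wa hab) w).
    apply: leq_trans (_ : _ <= 1 + \sum_(i < N.+1) (d.-1 ^ minn k.-1 (N.+1 - i)).*2) _.
      apply: leq_trans (near_core_edge_le hs P deg dple hab goodab).
      apply: subset_leq_card; apply/subsetP => B; rewrite inE => /andP[BE cB].
      by rewrite inE BE sub.
    by rewrite n3; apply: thread_count.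
  have [x' hxx' EA] := edge_endP hs AE xA.
  have conf B : B \in edge_set h -> conflict h N A B ->
      exists2 z, z \in A & exists2 y, y \in B & walk_le h N z y.
    move=> BE /orP[/eqP <-|/exists_inP[z zA /exists_inP[y yB w]]].
      by exists x => //; exists x => //; apply: walk_le_refl.
    by exists z => //; exists y.
  have tree_case a : walk_le hc k.-1 u0 a -> (forall z, z \in A -> below dp par a z) -> dp a = 0 ->
      exists a b, [/\ hc a b, walk_le hc k.-1 u0 a & forall B, B \in edge_set h -> conflict h N A B ->
        [exists y in B, walk_le h N a y || walk_le h N b y]].
    move=> wa bA da; have : nbrs hc a != set0.
      by rewrite -card_gt0 good //; apply: walk_le_mono wa; apply: leq_trans n1; apply: leq_addr.
    case/set0Pn => b; rewrite inE => hab; exists a, b; split=> // B BE /conf [] // z zA [y yB w].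
    apply/exists_inP; exists y => //.
    case: (walk_le_leave P (bA z zA) w) => [by_|[q leq wq]].
      by apply/orP; left; apply: walk_le_mono (walk_le_below hs P by_); rewrite da subn0; apply: leq_trans n4.
    by apply/orP; left; apply: walk_le_mono wq; apply: leq_trans leq; apply: leq_addr.
  case: (P2 _ _ hxx') => [[dx dx']|[dx' px']|[dx px]].
  + exists x, x'; split; first by rewrite /hc /core_rel hxx' dx dx'.
      by rewrite root0 in wrx.
    move=> B BE /conf [] // z; rewrite EA !inE => zx [y yB w].
    by apply/exists_inP; exists y => //; case/orP: zx w => /eqP-> ->; rewrite ?orbT.
  + apply: (tree_case _ wrx) => [z|]; last exact: root_core P.
    rewrite EA !inE => /orP[]/eqP->; first exact: below_root P _.
    by rewrite -px' (root_par P) ?dx' //; apply: below_root P _.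
  + apply: (tree_case _ wrx) => [z|]; last exact: root_core P.
    rewrite EA !inE => /orP[]/eqP->; first exact: below_root P _.
    by rewrite -(root_par P) ?dx // px; apply: below_root P _.
have notU A : A \in edge_set h :\: U -> A \in edge_set (del_edge h u0 u1) /\
    forall x, x \in A -> ~~ (walk_le h (k - 2) u0 x || walk_le h (k - 2) u1 x).
  move=> /setDP[AE AU]; have nA x : x \in A -> ~~ (walk_le h (k - 2) u0 x || walk_le h (k - 2) u1 x).
    by move=> xA; apply: contra AU => w; rewrite inE AE; apply/exists_inP; exists x.
  split=> //; have /edge_setP[x [y [hxy EA]]] := AE; apply/edge_setP; exists x, y.
  split=> //; rewrite /del_edge hxy -EA; apply/eqP => Eu.
  by have := nA u0; rewrite Eu !inE eqxx walk_le_refl => /(_ isT).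
move=> A B /notU[AE nA] /notU[BE nB] /orP[/eqP->|/exists_inP[x xA /exists_inP[y yB w]]].
  by split=> //; apply: conflict_refl.
split=> //; apply/orP; right; apply/exists_inP; exists x => //; apply/exists_inP; exists y => //.
case: (walk_le_del_edge u0 u1 w) => [//|[p [q [ltN wp wq]]]].
have le_p : k.-1 <= p.
  rewrite leqNgt; apply: contra (nA x xA) => ltp.
  have lep : p <= k - 2 by move: ltp k1; clear; lia.
  by case/orP: wp => /(walk_le_sym hs) /(walk_le_mono lep) ->; rewrite ?orbT.
have le_q : k.-1 <= q.
  rewrite leqNgt; apply: contra (nB y yB) => ltq.
  have leq : q <= k - 2 by move: ltq k1; clear; lia.
  by case/orP: wq => /(walk_le_mono leq) ->; rewrite ?orbT.
by move: le_p le_q ltN; rewrite /N; clear; lia.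
Qed.

(** Induction over the subgraphs [h] of [g] by their number of ordered adjacent pairs. The condition
    on [c] ranges over subgraphs of [g] because it is applied to the core of each [h]. *)
Lemma colorable_of_far_core (V : finType) (g : rel V) (k d : nat) :
    symmetric g -> irreflexive g -> 1 < k -> k.*2 < d ->
    (forall x, #|nbrs g x| <= d) ->
    (forall c : rel V, symmetric c -> subrel c g -> (exists x y, c x y) ->
      (forall x, #|nbrs c x| != 1) -> far_core c (3 * k - 2)) ->
  colorable g k.-1.*2 (d * \sum_(i < k) d.-1 ^ i).
Proof.
move=> gs gi k1 kd deg far; set K := d * _.
suff H n (h : rel V) : #|[set e : V * V | h e.1 e.2]| < n -> symmetric h -> subrel h g ->
    colorable h k.-1.*2 K by apply: H (ltnSn _) gs _.
elim: n h => // n IHn h ltn hs sub.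
have hi : irreflexive h.
  by move=> x; apply/negP => /sub; rewrite gi.
have degh x : #|nbrs h x| <= d.
  apply: leq_trans (deg x); apply: subset_leq_card; apply/subsetP => y.
  by rewrite !inE => /sub.
have shrink (h' : rel V) x y : symmetric h' -> subrel h' h -> h x y -> ~~ h' x y ->
    colorable h' k.-1.*2 K.
  move=> hs' sub' hxy nh'; apply: IHn => //; last by move=> u v /sub' /sub.
  rewrite -ltnS; apply: leq_trans ltn; rewrite ltnS; apply: proper_card.
  apply/properP; split; first by apply/subsetP => e; rewrite !inE => /sub'.
  by exists (x, y); rewrite inE.
have leaf_removal v p : h v p -> (forall y, h v y -> y = p) ->
    #|[set B in edge_set h | conflict h k.-1.*2 [set v; p] B]| <= K -> colorable h k.-1.*2 K.
  move=> hvp leaf leK; apply: (colorable_leaf hs hvp leaf leK).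
  apply: (shrink _ v p) => //.
  - by move=> x y; rewrite /del_vertex hs; congr (_ && _); rewrite andbC.
  - by move=> x y /and3P[].
  - by rewrite /del_vertex eqxx andbF.
case: (set_0Vmem (edge_set h)) => [E0|[E EE]].
  have K0 : 0 < K.
    by rewrite /K muln_gt0; apply/andP; split; [lia | case: (k) k1 => // k' _; rewrite big_ord_recl].
  by exists (fun=> Ordinal K0) => A B; rewrite E0 inE.
have [x0 [y0 [hxy0 _]]] := edge_setP _ _ EE.
have [dp [par [P F3]]] := peeling_exists hs hi; have [P1 P2] := P.
have leafP v w : below dp par w v -> 0 < dp v -> (forall y, below dp par w y -> dp y <= dp v) ->
    h v (par v) /\ forall y, h v y -> y = par v.
  move=> b dv deepest; split; first by case: (P1 v dv).
  move=> y hvy; case: (P2 _ _ hvy) => [[dx _]|[dy py]|[_ ->//]]; first by rewrite dx in dv.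
  by have := deepest y (below_child b dy py); rewrite dy ltnn.
have dp_iter i x : i <= dp x -> dp (iter i par x) = dp x - i.
  elim: i => [|i IHi] lei; first by rewrite subn0.
  have dxi := IHi (ltnW lei); rewrite iterS.
  have [_] : h (iter i par x) (par (iter i par x)) /\
      (dp (par (iter i par x))).+1 = dp (iter i par x).
    by apply: P1; rewrite dxi subn_gt0.
  by rewrite dxi; move: lei; clear; lia.
have [v _ deepv] : exists2 v, true & forall y, dp y <= dp v.
  by have [v _ vP] := @arg_maxnP _ x0 xpredT dp isT; exists v => // y; apply: vP.
(* A globally deepest [v] is also deepest below its ancestor [w] that lies [k] levels higher. *)
case: (leqP k (dp v)) => [lekv|ltvk].
  pose w := iter k par v.
  have dw : dp w = dp v - k by apply: dp_iter.
  have bw : below dp par w v by rewrite /below dw leq_subr subKn //=.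
  have [hv leafv] := leafP v w bw (leq_trans (ltnW k1) lekv) (fun y _ => deepv y).
  apply: (leaf_removal v (par v)) => //.
  have dvw : dp v - dp w = k by rewrite dw subKn.
  apply: (leaf_conflicts_le hs P (w := w)); rewrite ?dvw //; last by left.
  by rewrite -subn_gt0 dvw ltnW.
(* A component that is a tree with an edge: its core is the single vertex [c]. *)
case: (boolP [exists c, [&& dp c == 0, nbrs (core_rel h dp) c == set0 & [exists y, h c y]]]).
  case/existsP=> c /and3P[/eqP dc /eqP iso /existsP[y hcy]].
  have [u bu deepu] : exists2 u, below dp par c u & forall y, below dp par c y -> dp y <= dp u.
    by have [u bu uP] := @arg_maxnP _ c (below dp par c) dp (below_refl _ _ _); exists u => // ?; apply: uP.
  have du : 0 < dp u.
    have by_ : below dp par c y by apply: (walk_le_isolated P dc iso (walk_le1 hcy)).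
    apply: leq_trans (deepu _ by_).
    case: (P2 _ _ hcy) => [[_ dy]|[-> //]|[]]; last by rewrite dc.
    have : y \in nbrs (core_rel h dp) c by rewrite inE /core_rel hcy dc dy.
    by rewrite iso inE.
  have [hv leafv] := leafP u c bu du deepu.
  apply: (leaf_removal u (par u)) => //.
  apply: (leaf_conflicts_le hs P (w := c)) => //; rewrite dc ?subn0 //.
    by apply: leq_trans (deepv u) (ltnW ltvk).
  by right.
move=> /existsPn noiso.
(* The root of the tree of [x0] has an edge, hence by [noiso] a core edge. *)
have core_nonempty : exists x y, core_rel h dp x y.
  pose c := rooted_at dp par x0.
  have dc : dp c = 0 by apply: root_core P.
  have [z hcz] : exists z, h c z.
    have := walk_le_below hs P (below_root P x0); rewrite -/c dc subn0.
    case E' : (dp x0) => [|m]; first by move=> /eqP->; exists y0.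
    by case/walk_leSP => [->|[z hcz _]]; [exists y0 | exists z].
  have := noiso c; rewrite dc eqxx /=; rewrite negb_and => /orP[|/existsPn/(_ z)]; last by rewrite hcz.
  by case/set0Pn => y; rewrite inE; exists c, y.
have core_deg x : #|nbrs (core_rel h dp) x| != 1.
  case: (posnP (dp x)) => [/F3//|dx].
  apply/eqP => E1; have : nbrs (core_rel h dp) x != set0 by rewrite -card_gt0 E1.
  by case/set0Pn => y; rewrite inE /core_rel => /and3P[_]; rewrite eqn0Ngt dx.
have [u0 /set0Pn[u1 hu] good] := far (core_rel h dp) (core_sym dp hs)
  (fun x y hxy => sub _ _ (proj1 (andP hxy))) core_nonempty core_deg.
rewrite inE in hu; have hu' : h u0 u1 by case/and3P: hu.
apply: (far_edge_reduction hs P degh k1 kd _ hu good).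
  by move=> x; have := deepv x; lia.
apply: (shrink _ u0 u1) => //.
- by move=> x y; rewrite /del_edge hs [in LHS]setUC.
- by move=> x y /andP[].
- by rewrite /del_edge eqxx andbF.
Qed.

(** * Sparse cores contain long threads *)

(** Oriented edges, so twice the number of edges when [c] is symmetric and irreflexive. *)
Definition darts (V : finType) (c : rel V) := [set e : V * V | c e.1 e.2].
Definition support (V : finType) (c : rel V) := [set x | nbrs c x != set0].

Lemma card_darts (V : finType) (c : rel V) : #|darts c| = \sum_x #|nbrs c x|.
Proof.
rewrite -sum1dep_card (eq_bigr (fun x => \sum_(y | c x y) 1)); last first.
  by move=> x _; rewrite sum1dep_card.
by rewrite pair_big_dep.
Qed.

(** With [n] non-isolated vertices and [m] edges, sparsity reads [g m <= g n + 2 m]. If no vertex is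
    far, each of the [q] vertices of degree 2 is reached in at most [r] steps along a dart leaving
    the set [T] of vertices of degree at least 3, so [q <= r * S] for the degree sum [S] over [T].
    With [3 * #|T| <= S], sparsity gives [g * S <= 6 * S + 12 * q], against [12 * r + 6 < g]. *)
Lemma far_core_of_sparse (V : finType) (c : rel V) (g r : nat) :
    symmetric c -> (exists x y, c x y) -> (forall x, #|nbrs c x| != 1) ->
    g * #|darts c| <= g.*2 * #|support c| + 2 * #|darts c| -> 12 * r + 6 < g ->
  far_core c r.
Proof.
move=> cs [x0 [y0 c0]] deg1 sparse ltg.
pose T := [set x | 2 < #|nbrs c x|].
case: (boolP [exists u in support c, [forall y, walk_le c r u y ==> (y \notin T)]]).
  case/exists_inP => u; rewrite inE => u0 /forallP far; exists u => // y w.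
  have := far y; rewrite w /= inE -leqNgt => le2.
  have : #|nbrs c y| != 0.
    rewrite -lt0n card_gt0; case: r w {ltg far} => [/eqP <- //|r] /(walk_leSPr cs) [].
      case: r => [/eqP <- //|r] /(walk_le_sym cs) /walk_leSP[->//|[z cyz _]].
      by apply/set0Pn; exists z; rewrite inE.
    by move=> [z czy _]; apply/set0Pn; exists z; rewrite inE cs.
  have := deg1 y; move: #|nbrs c y| le2; clear; lia.
move=> /exists_inPn near; exfalso.
pose st (e : V * V) i := iter i (advance c) e.
pose DT := [set e in darts c | e.1 \in T].
(* Between vertices of degree 2 a walk without backtracking is determined by
   its first dart. *)
have trace j y u : y \in T -> walk_le c j y u -> u \in T \/ exists i e,
    [/\ i < j, e \in DT, forall i', i' <= i -> c (st e i').1 (st e i').2 & u = (st e i).2].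
  move=> yT; elim: j u => [|j IHj] u; first by move=> /eqP<-; left.
  case/(walk_leSPr cs) => [/IHj[|[i [e [lti eD ce ->]]]]|[z czu wz]]; first by left.
    by right; exists i, e; split=> //; apply: leqW.
  case: (boolP (u \in T)) => [|uT]; [by left | right].
  case: (boolP (z \in T)) => [zT|zT].
    exists 0, (z, u); split=> // [|i]; first by rewrite !inE czu; move: zT; rewrite inE.
    by rewrite leqn0 => /eqP->.
  case: (IHj _ wz) => [zT'|[i [e [lti eD ce Ez]]]]; first by rewrite zT' in zT.
  have z2 : #|nbrs c z| = 2.
    have : #|nbrs c z| != 0 by rewrite -lt0n card_gt0; apply/set0Pn; exists u; rewrite inE.
    have := deg1 z; move: zT; rewrite inE -leqNgt; move: #|nbrs c z|; clear; lia.
  have cpz : c (st e i).1 z by rewrite Ez ce.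
  have [co /(_ u czu)[Eu|Eu]] := two_nbrs cs z2 cpz.
    case: i lti ce Ez cpz co Eu => [|i] lti ce Ez cpz co Eu.
      by move: eD; rewrite inE => /andP[_]; rewrite -[e.1]/(st e 0).1 -Eu (negPf uT).
    exists i, e; split=> //; first by apply: leqW; apply: ltnW.
    by move=> i' lei; apply: ce; apply: leqW.
  exists i.+1, e; split=> //; last by rewrite Eu Ez.
  move=> i'; rewrite leq_eqVlt => /orP[/eqP->|]; last exact: ce.
  by rewrite /st iterS /= -/(st e i) -Ez.
have subT : T \subset support c.
  by apply/subsetP => x; rewrite !inE -card_gt0; apply: leq_trans.
pose S := \sum_(x in T) #|nbrs c x|.
have cardDT : #|DT| = S.
  rewrite -sum1dep_card /S (eq_bigr (fun x => \sum_(y | c x y) 1)); last first.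
    by move=> x _; rewrite sum1dep_card.
  rewrite pair_big_dep; apply: eq_bigl => -[x y] /=; by rewrite !inE andbC.
have cover : support c :\: T \subset \bigcup_(i < r) [set (st e i).2 | e in DT].
  apply/subsetP => u /setDP[us uT].
  have := near u us; rewrite negb_forall => /existsP[y]; rewrite negb_imply negbK => /andP[wuy yT].
  case: (trace r y u yT (walk_le_sym cs wuy)) => [uT'|[i [e [lti eD _ ->]]]].
    by rewrite uT' in uT.
  by apply/bigcupP; exists (Ordinal lti) => //; apply: imset_f.
have leq : #|support c :\: T| <= r * S.
  apply: leq_trans (subset_leq_card cover) _; rewrite -[r in r * _]card_ord.
  apply: card_bigcup_leq => i _; rewrite -cardDT; apply: leq_imset_card.
have cardn : #|support c| = #|T| + #|support c :\: T|.
  by rewrite -(cardsID T (support c)) (setIidPr subT).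
have cardM : #|darts c| = S + 2 * #|support c :\: T|.
  rewrite card_darts (bigID (mem T)) /= -/S; congr (_ + _).
  rewrite (bigID (mem (support c))) /= [X in _ + X]big1 ?addn0; last first.
    by move=> x /andP[_]; rewrite inE negbK => /eqP->; rewrite cards0.
  rewrite mulnC -sum_nat_const; apply: congr_big => // [x|x]; first by rewrite !inE.
  rewrite !inE -leqNgt -card_gt0 => /andP[le2 gt0].
  by have := deg1 x; move: #|nbrs c x| le2 gt0; clear; lia.
have le3T : 3 * #|T| <= S.
  by rewrite mulnC -sum_nat_const; apply: leq_sum => x; rewrite inE.
have S0 : 0 < S.
  have xs : x0 \in support c by rewrite inE; apply/set0Pn; exists y0; rewrite inE.
  have := near x0 xs; rewrite negb_forall => /existsP[y]; rewrite negb_imply negbK => /andP[_ yT].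
  apply: leq_trans le3T; rewrite muln_gt0 /= card_gt0; apply/set0Pn; by exists y.
move: sparse ltg leq le3T S0; rewrite cardn cardM -muln2; clear.
move: #|T| #|support c :\: T| S => t q s sparse ltg leq le3T S0.
have : g * s <= 6 * s + 12 * q by nia.
nia.
Qed.

(** * Sparsity from a face structure *)

(** Take a longest path. Its first vertex [x] has a neighbour [y] other than its successor; by
    maximality [y] is on the path, and the segment from [x] to [y] closes to a cycle. *)
Lemma ucycle_of_min_degree (V : finType) (s : rel V) :
    symmetric s -> irreflexive s -> (exists x y, s x y) ->
    (forall x, #|nbrs s x| != 1) ->
  exists p : seq V, [/\ 2 < size p, ucycle s p & {in p, forall x, 1 < #|nbrs s x|}].
Proof.
move=> ss si [x0 [y0 s0]] deg1.
pose L n := [exists t : n.-tuple V, exists x, path s x t && uniq (x :: t)].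
have L1 : L 1.
  apply/existsP; exists [tuple y0]; apply/existsP; exists x0; rewrite /= s0 /= inE.
  by rewrite andbT; apply: contraTneq s0 => ->; rewrite si.
have Lle n : L n -> n <= #|V|.
  case/existsP => t /existsP[x /andP[_ ut]].
  by have := max_card (mem (x :: t)); rewrite (card_uniqP ut) /= size_tuple; apply: ltnW.
have [n /existsP[t /existsP[x /andP[pt ut]]] nmax] := ex_maxnP (ex_intro _ 1 L1) Lle.
have deg2 u v : s u v -> 1 < #|nbrs s u|.
  move=> suv; have := deg1 u; have : #|nbrs s u| != 0.
    by rewrite -lt0n card_gt0; apply/set0Pn; exists v; rewrite inE.
  by move: #|_|; clear; lia.
have n1 : 0 < n by apply: nmax.
case: t pt ut => [[|x1 p] sz] pt ut; first by move/eqP: (sz) n1 => /= <-.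
have {}pt : path s x (x1 :: p) := pt.
have {}ut : uniq (x :: x1 :: p) := ut.
have [y sxy yx1] : exists2 y, s x y & y != x1.
  have s01 : s x x1 by case/andP: pt.
  have := deg2 x x1 s01; rewrite (cardsD1 x1) inE s01 ltnS card_gt0 => /set0Pn[y].
  by rewrite !inE => /andP[yx1 sxy]; exists y.
have yin : y \in x :: x1 :: p.
  apply: contraT => yn; have : L n.+1.
    apply/existsP; exists (@Tuple n.+1 _ (x :: x1 :: p) sz); apply/existsP; exists y.
    suff : path s y (x :: x1 :: p) && uniq (y :: x :: x1 :: p) by [].
    by rewrite cons_uniq yn ut !andbT [path _ _ _]/(s y x && path s x (x1 :: p)) ss sxy.
  by move/nmax; rewrite ltnn.
have yx : y != x by apply: contraTneq sxy => ->; rewrite si.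
have yp : y \in p by move: yin; rewrite !inE (negPf yx) (negPf yx1).
case/splitPr: yp pt ut {sz yin} => p1 p2.
rewrite -cat_rcons -!cat_cons cat_path cat_uniq => /andP[pt _] /andP[ut _].
exists (x :: x1 :: rcons p1 y); split; first by rewrite /= size_rcons.
  rewrite /ucycle ut andbT /cycle rcons_path.
  by move: pt; rewrite /= last_rcons => ->; rewrite ss.
have cyc : cycle s (x :: x1 :: rcons p1 y).
  rewrite /cycle rcons_path.
  by move: pt; rewrite /= last_rcons => ->; rewrite ss.
by move=> z zin; apply: (deg2 z (next (x :: x1 :: rcons p1 y) z)); apply: next_cycle.
Qed.

(** There is a cycle, with at least [g] vertices, each of degree at least 2. This will be applied to
    the boundary of a face. *)
Lemma darts_girth (V : finType) (s : rel V) (g : nat) :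
    symmetric s -> irreflexive s -> (exists x y, s x y) ->
    (forall x, #|nbrs s x| != 1) ->
    (forall p, 2 < size p -> ucycle s p -> g <= size p) ->
  g.*2 <= #|darts s|.
Proof.
move=> ss si ne deg1 girth.
have [p [szp cp degp]] := ucycle_of_min_degree ss si ne deg1.
rewrite card_darts; apply: (@leq_trans (\sum_(x in p) #|nbrs s x|)); last first.
  by rewrite [X in _ <= X](bigID (mem p)) leq_addr.
apply: (@leq_trans (\sum_(x in p) 2)); last by apply: leq_sum.
have /andP[_ up] := cp.
by rewrite sum_nat_const (card_uniqP up) -muln2 leq_mul2r girth.
Qed.

(** * Counting edge sets by odd vertices and faces *)

Section Counting.
Variables (V F : finType) (c : rel V) (g : nat) (lf rf : V -> V -> F).
Hypotheses (c_sym : symmetric c) (c_irr : irreflexive c).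
Hypothesis c_girth : forall p, 2 < size p -> ucycle c p -> g <= size p.
Hypotheses (lf_sym : forall x y, c x y -> lf x y = lf y x).
Hypotheses (rf_sym : forall x y, c x y -> rf x y = rf y x).

(** All degrees are even; for symmetric [z] this is membership in the cycle space modulo 2. *)
Definition even_rel (z : rel V) := forall x, \big[addb/false]_y z x y = false.

Hypothesis cycle_cut : forall z : rel V, symmetric z -> subrel z c -> even_rel z ->
  exists A : {set F}, forall x y, c x y -> z x y = (lf x y \in A) (+) (rf x y \in A).

(** The boundary of the face [f], that is, the star of [f] in the dual graph; an edge with [f] on
    both sides cancels. *)
Definition star f x y := c x y && ((lf x y == f) (+) (rf x y == f)).

Hypothesis star_even : forall f, even_rel (star f).

Let E := [set e in darts c | enum_rank e.1 < enum_rank e.2].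
Let swap (e : V * V) := (e.2, e.1).
Let srel (z : {set V * V}) : rel V := fun x y => ((x, y) \in z) (+) ((y, x) \in z).

Let E_swap e : e \in E -> swap e \notin E.
Proof. by rewrite !inE => /andP[_ lt]; rewrite negb_and -leqNgt (ltnW lt) orbT. Qed.

Let E_or e : e \in darts c -> e \in E \/ swap e \in E.
Proof.
rewrite !inE /= => ce; rewrite [c e.2 _]c_sym ce /=; case: (ltngtP (enum_rank e.1)) => [||E0]; auto.
by move: ce; rewrite (enum_rank_inj (val_inj E0)) c_irr.
Qed.

Let card_darts_E (s : rel V) : symmetric s -> subrel s c ->
  #|darts s| = #|[set e in E | s e.1 e.2]|.*2.
Proof.
move=> ss sub; set X := [set e in E | _].
have si : injective swap by case=> a b [a' b'] [-> ->].
have cardX : #|swap @: X| = #|X| by apply: card_imset.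
rewrite -addnn -{2}cardX -cardsUI.
have -> : X :&: swap @: X = set0.
  apply/setP => e; rewrite [RHS]inE; apply/negP => /setIP[eX /imsetP[e' e'X Ee]].
  move: eX e'X; rewrite !in_set Ee => /andP[/andP[_ +] _] /andP[/andP[_ +] _] /=.
  by move=> h1 h2; have := ltn_trans h1 h2; rewrite ltnn.
rewrite cards0 addn0; apply: eq_card => e; rewrite in_setU.
apply/idP/orP => [se|[|/imsetP[e' + ->]]]; last 2 first.
- by rewrite !inE => /andP[_].
- by rewrite !inE ss => /andP[_].
have se' : s e.1 e.2 by rewrite inE in se.
have [eE|eE] : e \in E \/ swap e \in E by apply: E_or; rewrite inE sub.
  by left; rewrite inE eE.
right; apply/imsetP; exists (swap e); last by case: (e).
by rewrite inE eE ss.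
Qed.

Let F' := [set f | [exists e in E, star f e.1 e.2]].

Let star_sym f : symmetric (star f).
Proof.
move=> x y; rewrite /star c_sym; case cyx : (c y x) => //=.
by rewrite -lf_sym // -rf_sym.
Qed.

Let even_deg (s : rel V) : even_rel s -> forall x, #|nbrs s x| != 1.
Proof.
move=> ev x; apply/cards1P => -[y Ey]; have := ev x.
rewrite (bigD1 y) //= big1 ?addbF => [|z zy].
  by have := in_set1 y y; rewrite -Ey inE eqxx => ->.
by have := in_set1 z y; rewrite -Ey inE (negPf zy).
Qed.

(** Double counting: the boundary of a face in [F'] is nonempty with even degrees, so it has at
    least [g] edges, and every edge lies on at most two boundaries. *)
Let faces_le : g * #|F'| <= #|darts c|.
Proof.
rewrite (card_darts_E c_sym) //.
have -> : [set e in E | c e.1 e.2] = E.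
  by apply/setP => e; rewrite !inE andbC andbA andbb.
rewrite mulnC -sum_nat_const.
apply: (@leq_trans (\sum_(f in F') #|[set e in E | star f e.1 e.2]|)).
  apply: leq_sum => f; rewrite inE => /exists_inP[e eE se].
  have subs : subrel (star f) c by move=> x y /andP[].
  rewrite -leq_double -card_darts_E //.
  apply: darts_girth => //; first by move=> x; rewrite /star c_irr.
  - by exists e.1, e.2.
  - exact: even_deg.
  - move=> p szp /andP[cp up]; apply: c_girth => //; rewrite /ucycle up andbT.
    by case: (p) cp => //= x q; apply: sub_path.
under eq_bigr do rewrite -sum1dep_card.
rewrite (exchange_big_dep (mem E)) /=; last by move=> f e _ /andP[].
rewrite -muln2 -sum_nat_const; apply: leq_sum => e _.
rewrite sum1dep_card; apply: (@leq_trans #|[set lf e.1 e.2; rf e.1 e.2]|); last first.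
  by rewrite cards2; case: eqP.
apply: subset_leq_card; apply/subsetP => f; rewrite !inE => /andP[_ /andP[_ /andP[_]]].
by rewrite eq_sym [_ == f]eq_sym; case: eqP; case: eqP.
Qed.

Let srel_sym z : symmetric (srel z).
Proof. by move=> x y; rewrite /srel addbC. Qed.

Let bdry (z : {set V * V}) := [set x | \big[addb/false]_y srel z x y].

Let srelE (z : {set V * V}) e : z \subset E -> e \in E -> srel z e.1 e.2 = (e \in z).
Proof.
move=> sz eE; rewrite /srel -surjective_pairing.
suff -> : (e.2, e.1) \in z = false by rewrite addbF.
by apply: contraNF (E_swap eE) => /(subsetP sz).
Qed.

(** A fixed edge set whose odd vertices form [w], if there is one; its sum with any other such set
    is a cycle. *)
Let rep (w : {set V}) := odflt set0 [pick z : {set V * V} | (z \subset E) && (bdry z == w)].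

Let symdiff (z z' : {set V * V}) := [set e | (e \in z) (+) (e \in z')].

Let repP (z : {set V * V}) : z \subset E -> rep (bdry z) \subset E /\ bdry (rep (bdry z)) = bdry z.
Proof.
move=> sz; rewrite /rep; case: pickP => [w /andP[-> /eqP]//|none].
by have := none z; rewrite sz eqxx.
Qed.

Let good (z : {set V * V}) (A : {set F}) := [forall e in E,
  (e \in symdiff z (rep (bdry z))) == (lf e.1 e.2 \in A) (+) (rf e.1 e.2 \in A)].

Let code (z : {set V * V}) := odflt set0 [pick A : {set F} | good z A].

(** The sum of [z] and its representative has no odd vertex, so [cycle_cut] supplies the faces. *)
Let codeP (z : {set V * V}) : z \subset E -> good z (code z).
Proof.
move=> sz; rewrite /code; case: pickP => [//|none]; exfalso.
have [sr br] := repP sz; set w := symdiff z (rep (bdry z)).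
have sw : w \subset E.
  by apply/subsetP => e; rewrite inE; case ez : (e \in z) => /=; [move=> _; apply: (subsetP sz) | apply: (subsetP sr)].
have wsrel x y : srel w x y = srel z x y (+) srel (rep (bdry z)) x y.
  by rewrite /srel !inE addbACA.
have ev : even_rel (srel w).
  move=> x; under eq_bigr do rewrite wsrel; rewrite big_split /=.
  have := congr1 (fun X : {set V} => x \in X) br; rewrite !inE => ->.
  exact: addbb.
have subw : subrel (srel w) c.
  move=> x y; rewrite /srel; case xy : (_ \in w) => /=.
    by move=> _; have := subsetP sw _ xy; rewrite !inE => /andP[].
  by move=> yx; have := subsetP sw _ yx; rewrite !inE c_sym => /andP[].
have [A AP] := cycle_cut (srel_sym w) subw ev.
have := none A => /negbT/negP; apply; apply/forall_inP => e eE.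
by rewrite -AP ?srelE // ; move: eE; rewrite !inE => /andP[].
Qed.

Let goodE (z : {set V * V}) e : z \subset E -> e \in E ->
  (e \in z) (+) (e \in rep (bdry z)) =
    (lf e.1 e.2 \in code z) (+) (rf e.1 e.2 \in code z).
Proof. by move=> sz eE; have /forall_inP/(_ e eE)/eqP <- := codeP sz; rewrite inE. Qed.

(** An edge with equal sides contributes nothing, and one with different sides has both of them in
    [F']. *)
Let cut_faces (A A' : {set F}) e : e \in E -> A :&: F' = A' :&: F' ->
  (lf e.1 e.2 \in A) (+) (rf e.1 e.2 \in A) = (lf e.1 e.2 \in A') (+) (rf e.1 e.2 \in A').
Proof.
move=> eE EA; case: (eqVneq (lf e.1 e.2) (rf e.1 e.2)) => [->|neq]; first by rewrite !addbb.
have ce : c e.1 e.2 by move: eE; rewrite !inE => /andP[].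
have inF f : (f == lf e.1 e.2) || (f == rf e.1 e.2) -> f \in F'.
  move=> fe; rewrite inE; apply/exists_inP; exists e => //; rewrite /star ce.
  by case/orP: fe => /eqP->; rewrite eqxx ?(negPf neq) // eq_sym (negPf neq).
have AE f : f \in F' -> (f \in A) = (f \in A').
  by move=> fF; have := congr1 (fun X : {set F} => f \in X) EA; rewrite !in_setI fF !andbT.
by rewrite !AE // inF ?eqxx ?orbT.
Qed.

(* A set of edges is determined by its set of odd vertices and, after adding a
   fixed set with the same odd vertices, by the faces of a bounded region. *)
Lemma darts_le_support_faces :
  g * #|darts c| <= g.*2 * #|support c| + 2 * #|darts c|.
Proof.
have cardE : #|darts c| = #|E|.*2.
  rewrite (card_darts_E c_sym) //; congr _.*2; apply: eq_card => e.
  by rewrite !inE andbC andbA andbb.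
pose phi z := (bdry z, code z :&: F').
have phi_inj : {in powerset E &, injective phi}.
  move=> z z'; rewrite !powersetE => sz sz' Ephi.
  have Eb : bdry z = bdry z' := congr1 fst Ephi.
  have Ec : code z :&: F' = code z' :&: F' := congr1 snd Ephi.
  have eq_e e : e \in E -> (e \in z) (+) (e \in rep (bdry z)) = (e \in z') (+) (e \in rep (bdry z')).
    move=> eE; apply: etrans (goodE sz eE) (etrans _ (esym (goodE sz' eE))).
    exact: cut_faces eE Ec.
  apply/setP => e; case eE : (e \in E).
    by have := eq_e e eE; rewrite Eb => /addIb.
  have notin (y : {set V * V}) : y \subset E -> (e \in y) = false.
    by move=> sy; apply: contraFF eE => /(subsetP sy).
  by rewrite (notin z sz) (notin z' sz').
(* Comparing powers of 2 gives [m <= n + f], which is then combined with [g f <= 2 m]. *)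
have : #|powerset E| <= #|setX (powerset (support c)) (powerset F')|.
  rewrite -(card_in_imset phi_inj); apply: subset_leq_card; apply/subsetP => w.
  case/imsetP => z; rewrite powersetE => sz ->; rewrite in_setX !powersetE subsetIr andbT /=.
  apply/subsetP => x; rewrite !inE; apply: contraTneq => iso; rewrite big1 // => y _.
  have nc : c x y = false by have := in_set0 y; rewrite -iso inE.
  rewrite /srel; apply/negbTE; case xy : ((x, y) \in z) => /=.
    by have := subsetP sz _ xy; rewrite !inE nc.
  by apply/negP => /(subsetP sz); rewrite !inE c_sym nc.
rewrite cardsX !card_powerset -expnD leq_exp2l // => leE.
have := faces_le; rewrite cardE; move: leE; rewrite -!muln2; clear.
by move: #|E| #|F'| #|support c| => e f n; nia.
Qed.

End Counting.

(** * Cycles of the square grid *)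

Section Xor.
Variable I : finType.

Lemma xor_cst (F : pred I) (b : bool) :
  \big[addb/false]_i (F i && b) = (\big[addb/false]_i F i) && b.
Proof. by case: b; [rewrite andbT; apply: eq_bigr => i _; rewrite andbT | rewrite andbF big1 // => i _; rewrite andbF]. Qed.

Lemma xor_eq (x : I) : \big[addb/false]_i (i == x) = true.
Proof. by rewrite (bigD1 x) //= eqxx big1 // => i /negPf. Qed.

(** Every unordered pair is counted twice. *)
Lemma xor_symmetric (A : {set I}) (f : rel I) : symmetric f -> irreflexive f ->
  \big[addb/false]_(i in A) \big[addb/false]_(j in A) f i j = false.
Proof.
move=> fs fi; elim: {A}_.+1 {-2}A (ltnSn #|A|) => // n IHn A ltA.
case: (set_0Vmem A) => [->|[x xA]]; first by rewrite big_set0.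
have split F : \big[addb/false]_(i in A) F i = F x (+) \big[addb/false]_(i in A :\ x) F i.
  by rewrite (bigD1 x) //=; congr (_ (+) _); apply: eq_bigl => i; rewrite !inE andbC.
rewrite split (eq_bigr _ (fun i _ => split _)) big_split /= split fi /=.
rewrite (eq_bigr _ (fun i _ => fs i x)) addbA addbb /=; apply: IHn.
by move: ltA; rewrite (cardsD1 x A) xA.
Qed.

End Xor.

Section Grid.
Variable n : nat.

Definition grid : finType := ('I_n.+1 * 'I_n.+1)%type.
(** One more row and column than points, so that edges on the rim also have a square on either
    side. *)
Definition square : finType := ('I_n.+2 * 'I_n.+2)%type.

Definition grid_adj : rel grid := fun p q =>
  ((p.2 == q.2) && ((p.1.+1 == q.1) || (q.1.+1 == p.1))) ||
  ((p.1 == q.1) && ((p.2.+1 == q.2) || (q.2.+1 == p.2))).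

Definition inner (p : grid) := [&& 0 < p.1, p.1 < n, 0 < p.2 & p.2 < n].

(* The two squares on the sides of a grid edge; square (i, j) has the point
   (i, j) as its upper right corner. *)
Definition side1 (p q : grid) : square :=
  if p.2 == q.2 then (inord (maxn p.1 q.1), inord p.2.+1)
  else (inord p.1.+1, inord (maxn p.2 q.2)).
Definition side2 (p q : grid) : square :=
  if p.2 == q.2 then (inord (maxn p.1 q.1), inord p.2)
  else (inord p.1, inord (maxn p.2 q.2)).

Lemma grid_adj_sym : symmetric grid_adj.
Proof. by move=> p q; rewrite /grid_adj ![q.1 == _]eq_sym ![q.2 == _]eq_sym ![_.+1 == _]eq_sym; lia. Qed.

Lemma grid_adj_irr : irreflexive grid_adj.
Proof. by move=> p; rewrite /grid_adj !eqxx; lia. Qed.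

Lemma side1_sym p q : grid_adj p q -> side1 p q = side1 q p.
Proof.
rewrite /grid_adj /side1 [q.2 == _]eq_sym (maxnC q.1) (maxnC q.2).
by case: eqP => [->|] //= _ /andP[/eqP->].
Qed.

Lemma side2_sym p q : grid_adj p q -> side2 p q = side2 q p.
Proof.
rewrite /grid_adj /side2 [q.2 == _]eq_sym (maxnC q.1) (maxnC q.2).
by case: eqP => [->|] //= _ /andP[/eqP->].
Qed.

Lemma xor_neighbours (p : grid) (F : pred grid) : inner p ->
  \big[addb/false]_q (grid_adj p q && F q) =
    (F (inord p.1.+1, p.2) (+) F (inord p.1.-1, p.2)) (+)
    (F (p.1, inord p.2.+1) (+) F (p.1, inord p.2.-1)).
Proof.
case: p => i j /and4P[/= i0 iN j0 jN].
have iS : (inord i.+1 : 'I_n.+1) = i.+1 :> nat by rewrite inordK.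
have iP : (inord i.-1 : 'I_n.+1) = i.-1 :> nat by rewrite inordK //; lia.
have jS : (inord j.+1 : 'I_n.+1) = j.+1 :> nat by rewrite inordK.
have jP : (inord j.-1 : 'I_n.+1) = j.-1 :> nat by rewrite inordK //; lia.
pose s : seq grid := [:: (inord i.+1, j); (inord i.-1, j); (i, inord j.+1); (i, inord j.-1)].
have us : uniq s.
  rewrite /= !inE !xpair_eqE -!val_eqE /= !iS !iP !jS !jP; lia.
transitivity (\big[addb/false]_(q in s) F q).
  rewrite big_mkcond [RHS]big_mkcond; apply: eq_bigr => -[i' j'] _ /=.
  have -> : ((i', j') \in s) = grid_adj (i, j) (i', j').
    by rewrite !inE !xpair_eqE -!val_eqE /= !iS !iP !jS !jP /grid_adj /= -!val_eqE /=; lia.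
  by case: ifP.
by rewrite -big_uniq //= !big_cons big_nil addbF addbA.
Qed.

Definition even_chain (f : rel grid) := forall p, inner p -> \big[addb/false]_q f p q = false.

(* A cycle of the grid bounds the squares from which an odd number of its edges
   is crossed on the way down. *)
Lemma chain_bounds (f : rel grid) :
    symmetric f -> (forall p q, f p q -> [/\ grid_adj p q, inner p & inner q]) ->
    even_chain f ->
  exists A : {set square}, forall p q, grid_adj p q ->
    f p q = (side1 p q \in A) (+) (side2 p q \in A).
Proof.
move=> fs fsupp fev.
(* [hs i j] and [vs i j] are the values of [f] on the edges that reach [(i, j)] from the left and
   from below, and false off the grid. *)
pose hs i j := [&& 0 < i, i <= n, j <= n & f (inord i.-1, inord j) (inord i, inord j)].
pose vs i j := [&& 0 < j, i <= n, j <= n & f (inord i, inord j.-1) (inord i, inord j)].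
have id4 i j : (hs i.+1 j (+) hs i j) (+) (vs i j.+1 (+) vs i j) = false.
  case: (boolP [&& 0 < i, i < n, 0 < j & j < n]) => [ij|].
    have /and4P[i0 iN j0 jN] := ij.
    have [iE jE] : (inord i : 'I_n.+1) = i :> nat /\ (inord j : 'I_n.+1) = j :> nat by rewrite !inordK // ltnW.
    have ip : inner (inord i, inord j) by rewrite /inner /= iE jE.
    have := fev _ ip; rewrite (eq_bigr (fun q => grid_adj (inord i, inord j) q && f (inord i, inord j) q)).
      rewrite xor_neighbours //= iE jE /hs /vs /= iN jN i0 j0 (ltnW iN) (ltnW jN) /=.
      by rewrite [f (inord i.-1, _) _]fs [f (_, inord j.-1) _]fs.
    by move=> q _; case fq : (f _ q); rewrite ?andbF //; case: (fsupp _ _ fq) => ->.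
  move=> nij; have off p : p = (inord i, inord j) -> i <= n -> j <= n -> forall q, f p q = false.
    move=> -> lei lej q; apply: contraNF nij => /fsupp[_ + _].
    by rewrite /inner /= !inordK.
  have offl p q : q = (inord i, inord j) -> i <= n -> j <= n -> f p q = false.
    by move=> Eq lei lej; rewrite fs; apply: off.
  have -> : hs i.+1 j = false.
    by apply/negP => /and4P[_ lti lej]; rewrite (off _ erefl) // ltnW.
  have -> : hs i j = false.
    by apply/negP => /and4P[_ lei lej]; rewrite (offl _ _ erefl).
  have -> : vs i j.+1 = false.
    by apply/negP => /and4P[_ lei ltj]; rewrite (off _ erefl) // ltnW.
  have -> : vs i j = false.
    by apply/negP => /and4P[_ lei lej]; rewrite (offl _ _ erefl).
  by [].
(* The parity of the horizontal edges of [f] below the square [(i, j)]. The jump across a vertical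
   edge follows by induction on the height, from the even degrees [id4]. *)
pose a i j := \big[addb/false]_(j' < j) hs i j'.
have aS i j : a i j.+1 = a i j (+) hs i j by rewrite /a big_ord_recr.
have vsE i j : vs i j = a i.+1 j (+) a i j.
  elim: j => [|j IHj]; first by rewrite /a !big_ord0 /vs.
  have := id4 i j; rewrite IHj !aS.
  by case: (hs i.+1 j); case: (hs i j); case: (vs i j.+1); case: (a i.+1 j); case: (a i j).
exists [set s : square | a s.1 s.2] => -[i j] [i' j'].
have insq k : k <= n.+1 -> (inord k : 'I_n.+2) = k :> nat by move=> lek; rewrite inordK.
have lei (k : 'I_n.+1) : k <= n.+1 by apply: ltnW.
have max_le (k k' : 'I_n.+1) : maxn k k' <= n.+1 by rewrite geq_max !lei.
have hor (k k' l : 'I_n.+1) : k.+1 = k' -> f (k, l) (k', l) = a k' l.+1 (+) a k' l.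
  move=> Ek; rewrite (aS k' l) addbAC addbb addFb /hs.
  have -> : k'.-1 = k by rewrite -Ek.
  by rewrite -{1}Ek !leq_ord !inord_val.
have ver (k l l' : 'I_n.+1) : l.+1 = l' -> f (k, l) (k, l') = a k.+1 l' (+) a k l'.
  move=> El; rewrite -(vsE k l') /vs.
  have -> : l'.-1 = l by rewrite -El.
  by rewrite -{1}El !leq_ord !inord_val.
rewrite /grid_adj /side1 /side2 !inE /=; case: (eqVneq j j') => [<-|neqj] /= adj.
  have [E|E] : i.+1 = i' \/ i'.+1 = i by lia.
    by rewrite (hor _ _ _ E) !insq // (maxn_idPr _) // -E.
  by rewrite fs (hor _ _ _ E) !insq // (maxn_idPl _) // -E.
have /andP[/eqP Ei {}adj] := adj.
subst i'; have [E|E] : j.+1 = j' \/ j'.+1 = j by lia.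
  by rewrite (ver _ _ _ E) !insq // (maxn_idPr _) // -E.
by rewrite fs (ver _ _ _ E) !insq // (maxn_idPl _) // -E.
Qed.

(** Each of the four squares around an inner point is a side of exactly two of the edges there. *)
Lemma bounds_even (A : {set square}) : even_chain (fun p q =>
  grid_adj p q && ((side1 p q \in A) (+) (side2 p q \in A))).
Proof.
move=> p ip; rewrite xor_neighbours //; case: p ip => i j /and4P[/= i0 iN j0 jN].
have iS : (inord i.+1 : 'I_n.+1) = i.+1 :> nat by rewrite inordK.
have iP : (inord i.-1 : 'I_n.+1) = i.-1 :> nat by rewrite inordK //; lia.
have jS : (inord j.+1 : 'I_n.+1) = j.+1 :> nat by rewrite inordK.
have jP : (inord j.-1 : 'I_n.+1) = j.-1 :> nat by rewrite inordK //; lia.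
rewrite /side1 /side2 /= !eqxx -!val_eqE /= jS jP.
have -> : (j == j.+1 :> nat) = false by lia.
have -> : (j == j.-1 :> nat) = false by lia.
rewrite iS iP (maxn_idPr (leqnSn i)) (maxn_idPl (leq_pred i)).
rewrite (maxn_idPr (leqnSn j)) (maxn_idPl (leq_pred j)).
set x1 := (inord i.+1, inord j.+1) \in A; set x2 := (inord i.+1, inord j) \in A.
set x3 := (inord i, inord j.+1) \in A; set x4 := (inord i, inord j) \in A.
by case: x1; case: x2; case: x3; case: x4.
Qed.

End Grid.

(** * Minors of the grid *)

Definition induced_rel (T : finType) (e : rel T) (A : {set T}) : rel T :=
  fun p q => [&& e p q, p \in A & q \in A].

(** [B x] is the branch set of [x], connected through its base point [b x], and [a x y] is the end
    in [B x] of the grid edge that realizes [xy]. Branch sets avoid the rim, so their points have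
    all four neighbours. *)
Definition grid_minor (V : finType) (c : rel V) :=
  exists n (B : V -> {set grid n}) (b : V -> grid n) (a : V -> V -> grid n),
  [/\ forall x p, p \in B x -> connect (induced_rel (@grid_adj n) (B x)) (b x) p,
      forall x y p, p \in B x -> p \in B y -> x = y,
      forall x y, c x y -> [/\ a x y \in B x, a y x \in B y & grid_adj (a x y) (a y x)]
    & forall x p, p \in B x -> inner p].

(** The edges of a path, summed modulo 2, have odd degree only at its two ends, which cancel if they
    coincide. *)
Lemma connect_chain (T : finType) (e : rel T) (x y : T) :
    symmetric e -> irreflexive e -> connect e x y ->
  exists f : rel T, [/\ symmetric f, subrel f e &
    forall u, \big[addb/false]_v f u v = (u == x) (+) (u == y)].
Proof.
move=> es ei /connectP[p + ->]; elim: p x => [|z p IHp] x /=.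
  move=> _; exists (fun _ _ => false); split=> // u.
  by rewrite big1 // addbb.
case/andP => exz /IHp [f [fs fe fb]].
pose g : rel T := fun u v => ((u == x) && (v == z)) (+) ((u == z) && (v == x)).
have xz : x != z by apply: contraTneq exz => ->; rewrite ei.
exists (fun u v => g u v (+) f u v); split.
- by move=> u v; rewrite fs /g addbC andbC [(u == z) && _]andbC [in RHS]addbC; case: (_ && _) ; case: (_ && _).
- move=> u v; case fuv: (f u v); first by rewrite (fe _ _ fuv).
  rewrite addbF /g; case: (eqVneq u x) => [->|ux] /=.
    by rewrite (negPf xz) addbF => /eqP->.
  by case/andP => /eqP-> /eqP->; rewrite es.
- move=> u; rewrite big_split /= fb big_split /=.
  under eq_bigr do rewrite andbC; rewrite xor_cst xor_eq.
  under [X in _ (+) X (+) _]eq_bigr do rewrite andbC; rewrite xor_cst xor_eq /=.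
  by rewrite addbA -[_ (+) _ (+) (u == z)]addbA addbb addbF.
Qed.

Section Minor.
Variables (V : finType) (c : rel V) (n : nat).
Variables (B : V -> {set grid n}) (b : V -> grid n) (a : V -> V -> grid n).
Hypotheses (c_sym : symmetric c) (c_irr : irreflexive c).
Hypothesis conn : forall x p, p \in B x -> connect (induced_rel (@grid_adj n) (B x)) (b x) p.
Hypothesis disj : forall x y p, p \in B x -> p \in B y -> x = y.
Hypothesis contact : forall x y, c x y ->
  [/\ a x y \in B x, a y x \in B y & grid_adj (a x y) (a y x)].
Hypothesis innerB : forall x p, p \in B x -> inner p.

Let H : rel (grid n) := fun p q =>
  [exists x, (p \in B x) && (q \in B x)] ||
  [exists x, exists y, [&& c x y, p == a x y & q == a y x]].

(** One may pass between squares across a grid edge outside [H]. The classes of [linked] are the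
    faces of the minor, each named by its [root]. *)
Let cross : rel (square n) := fun s s' =>
  [exists p, exists q, [&& grid_adj p q, ~~ H p q, s == side1 p q & s' == side2 p q]].
Let linked : rel (square n) := fun s s' => cross s s' || cross s' s.

Definition face1 x y := root linked (side1 (a x y) (a y x)).
Definition face2 x y := root linked (side2 (a x y) (a y x)).

Let linked_sym : connect_sym linked.
Proof. by apply: sym_connect_sym => s s'; rewrite /linked orbC. Qed.

Let same_root p q : grid_adj p q -> ~~ H p q -> root linked (side1 p q) = root linked (side2 p q).
Proof.
move=> adj nH; apply/(rootP linked_sym); apply: connect1; apply/orP; left.
by apply/existsP; exists p; apply/existsP; exists q; rewrite adj nH !eqxx.
Qed.

(** Route the cycle through the grid: for every dart [(x, y)] of [z] take a path from [b x] to
    [a x y] in [B x] and the contact edge. The result bounds a set [A] of squares by [chain_bounds];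
    it stays inside [H], so [A] is a union of faces, and on contact edges it agrees with [z]. *)
Lemma minor_cycle_cut (z : rel V) : symmetric z -> subrel z c -> even_rel z ->
  exists A : {set square n}, forall x y, c x y ->
    z x y = (face1 x y \in A) (+) (face2 x y \in A).
Proof.
move=> zs zc zev.
have rho_ex x y : exists f : rel (grid n), c x y ->
    [/\ symmetric f, subrel f (induced_rel (@grid_adj n) (B x)) &
      forall u, \big[addb/false]_v f u v = (u == b x) (+) (u == a x y)].
  case cxy : (c x y); last by exists (fun _ _ => false).
  have [axy _ _] := contact cxy.
  have [| |f fP] := connect_chain _ _ (conn axy); last by exists f.
    by move=> p q; rewrite /induced_rel grid_adj_sym; congr (_ && _); rewrite andbC.
  by move=> p; rewrite /induced_rel grid_adj_irr.
have [rho rhoP] : exists rho : V -> V -> rel (grid n), forall x y, c x y ->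
    [/\ symmetric (rho x y), subrel (rho x y) (induced_rel (@grid_adj n) (B x)) &
      forall u, \big[addb/false]_v rho x y u v = (u == b x) (+) (u == a x y)].
  by have [rho rhoP] := fin_all_exists (fun x => fin_all_exists (rho_ex x)); exists rho.
(* Each [rho] is symmetric, while a contact edge gets its two directions from the two darts of its
   edge. *)
pose f : rel (grid n) := fun u v => \big[addb/false]_(e : V * V)
  (z e.1 e.2 && (rho e.1 e.2 u v (+) ((u == a e.1 e.2) && (v == a e.2 e.1)))).
have fs : symmetric f.
  move=> u v; rewrite /f.
  under eq_bigr do rewrite andb_addr; rewrite big_split /=.
  under [in RHS]eq_bigr do rewrite andb_addr; rewrite big_split /=; congr (_ (+) _).
    apply: eq_bigr => e _; case ze : (z e.1 e.2) => //=.
    by have [-> _ _] := rhoP _ _ (zc _ _ ze).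
  rewrite (reindex_inj (h := fun e : V * V => (e.2, e.1))) /=.
    by apply: eq_bigr => e _; rewrite zs [(u == _) && _]andbC.
  by case=> ? ? [? ?] [-> ->].
have fH p q : f p q -> grid_adj p q /\ H p q.
  move=> fpq; have : [exists e : V * V, z e.1 e.2 && (rho e.1 e.2 p q (+) ((p == a e.1 e.2) && (q == a e.2 e.1)))].
    apply: contraTT fpq => /existsPn none; rewrite /f big1 // => e _.
    exact: negbTE (none e).
  case/existsP => e /andP[/zc ce]; have [_ rs _] := rhoP _ _ ce; have [ax ay adj] := contact ce.
  case rpq : (rho _ _ p q) => /=.
    have /and3P[adjpq pB qB] := rs _ _ rpq; split=> //.
    by apply/orP; left; apply/existsP; exists e.1; rewrite pB.
  move=> /andP[/eqP-> /eqP->]; split=> //; apply/orP; right.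
  by apply/existsP; exists e.1; apply/existsP; exists e.2; rewrite ce !eqxx.
have Hin p q : H p q -> inner p /\ inner q.
  case/orP => [/existsP[x /andP[pB qB]]|/existsP[x /existsP[y /and3P[cxy /eqP-> /eqP->]]]].
    by split; apply: innerB; eassumption.
  by have [ax ay _] := contact cxy; split; apply: innerB; eassumption.
(* The end of a path at [a x y] cancels with the contact edge; at [b x] there remains the degree of
   [x] in [z]. *)
have fev u : \big[addb/false]_v f u v = false.
  rewrite /f exchange_big /=.
  rewrite (eq_bigr (fun e : V * V => (e.1 == e.1) && ((u == b e.1) && z e.1 e.2))).
    rewrite -(pair_bigA _ (fun x y => (x == x) && ((u == b x) && z x y))) /=.
    rewrite big1 // => x _; rewrite eqxx /=; under eq_bigr do rewrite andbC.
    by rewrite xor_cst zev.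
  move=> [x y] _ /=; rewrite eqxx /=; case zxy : (z x y); last by rewrite andbF big1.
  rewrite andbT /= big_split /=; have [_ _ ->] := rhoP _ _ (zc _ _ zxy).
  under eq_bigr do rewrite andbC; rewrite xor_cst xor_eq /=.
  by rewrite -addbA addbb addbF.
have [A AP] := chain_bounds fs (fun p q fpq =>
  let: conj adj h := fH p q fpq in let: conj ip iq := Hin p q h in And3 adj ip iq) (fun p _ => fev p).
have Aroot s : (root linked s \in A) = (s \in A).
  apply: (@closed_connect _ linked (mem A)); last by rewrite linked_sym connect_root.
  suff cl s1 s2 : cross s1 s2 -> (s1 \in A) = (s2 \in A).
    by move=> s1 s2 /orP[/cl|/cl ->].
  move=> /existsP[p /existsP[q /and4P[adj nH /eqP-> /eqP->]]].
  have : f p q = false by apply: contraNF nH => /fH[].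
  by rewrite AP //; case: (_ \in A); case: (_ \in A).
exists A => x y cxy; have [ax ay adj] := contact cxy.
rewrite /face1 /face2 !Aroot -AP // /f (bigD1 (x, y)) //= !eqxx big1 => [|[x' y'] /= ne].
  rewrite addbF; case zxy : (z x y) => //=; have [_ rs _] := rhoP _ _ cxy.
  case r : (rho x y _ _) => //; have /and3P[_ _ ay'] := rs _ _ r.
  by move: cxy; rewrite (disj ay ay') c_irr.
case zxy : (z x' y') => //=; have cxy' := zc _ _ zxy; have [_ rs _] := rhoP _ _ cxy'.
have [ax' ay' _] := contact cxy'.
case r : (rho _ _ _ _) => /=.
  have /and3P[_ ax2 ay2] := rs _ _ r.
  by move: cxy; rewrite (disj ax ax2) (disj ay ay2) c_irr.
apply/negP => /andP[/eqP Ex /eqP Ey].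
rewrite -Ex in ax'; rewrite -Ey in ay'.
by move: ne; rewrite (disj ax ax') (disj ay ay') eqxx.
Qed.

(** Sum the even degrees of the boundary of the face in the grid over [B x]: edges within [B x]
    count twice, and the others are exactly the contact edges at [x] that bound the face. *)
Lemma minor_star_even (s0 : square n) : even_rel (star c face1 face2 s0).
Proof.
move=> x.
pose A := [set s | root linked s == s0].
pose f p q := grid_adj p q && ((side1 p q \in A) (+) (side2 p q \in A)).
have fs : symmetric f.
  move=> p q; rewrite /f grid_adj_sym; case adj : (grid_adj q p) => //=.
  by rewrite (side1_sym adj) (side2_sym adj).
have fi : irreflexive f by move=> p; rewrite /f grid_adj_irr.
have fH p q : f p q -> H p q.
  case/andP => adj; apply: contraTT => nH.
  by rewrite !inE (same_root adj nH) addbb.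
have : \big[addb/false]_(p in B x) \big[addb/false]_q f p q = false.
  by rewrite big1 // => p pB; apply: bounds_even; apply: innerB pB.
under eq_bigr do rewrite (bigID (mem (B x))) /=.
rewrite big_split /= (xor_symmetric (B x) fs fi) /= => S0.
rewrite -[RHS]S0.
have starE y : star c face1 face2 s0 x y = c x y && f (a x y) (a y x).
  rewrite /star; case cxy : (c x y) => //=; have [_ _ adj] := contact cxy.
  by rewrite /f adj !inE.
transitivity (\big[addb/false]_y \big[addb/false]_(p in B x) \big[addb/false]_(q | q \notin B x)
    [&& c x y, p == a x y, q == a y x & f p q]).
  apply: eq_bigr => y _; rewrite starE; case cxy : (c x y) => /=; last first.
    by rewrite big1 // => p _; rewrite big1.
  have [ax ay adj] := contact cxy; have ayn : a y x \notin B x.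
    by apply: contraTN (cxy) => ay'; rewrite (disj ay ay') c_irr.
  rewrite (bigD1 (a x y)) //= [X in _ (+) X]big1 ?addbF => [|p /andP[_ /negPf->]]; last by rewrite big1.
  rewrite (bigD1 (a y x)) //= !eqxx [X in _ (+) X]big1 ?addbF // => q /andP[_ /negPf->].
  by rewrite andbF.
rewrite exchange_big /=; apply: eq_bigr => p pB.
rewrite exchange_big /=; apply: eq_bigr => q qB.
case fpq : (f p q); last by rewrite big1 // => y _; rewrite !andbF.
case/orP: (fH _ _ fpq) => [/existsP[x' /andP[pB' qB']]|/existsP[x' /existsP[y /and3P[cxy /eqP Ep /eqP Eq]]]].
  by move: qB; rewrite (disj pB pB') qB'.
have [ax ay _] := contact cxy; have Ex : x = x' by apply: (disj pB); rewrite Ep.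
subst x'; rewrite (bigD1 y) //= cxy -Ep -Eq !eqxx big1 // => y' ne.
case cxy' : (c x y') => //=; apply/negP => /and3P[_ /eqP Eq' _].
have [_ ay' _] := contact cxy'; rewrite -Eq' Eq in ay'.
by move: ne; rewrite (disj ay ay') eqxx.
Qed.

Lemma face1_sym x y : c x y -> face1 x y = face1 y x.
Proof. by move=> cxy; have [_ _ adj] := contact cxy; rewrite /face1 side1_sym. Qed.

Lemma face2_sym x y : c x y -> face2 x y = face2 y x.
Proof. by move=> cxy; have [_ _ adj] := contact cxy; rewrite /face2 side2_sym. Qed.

End Minor.

Lemma minor_sparse (V : finType) (c : rel V) (g : nat) :
    symmetric c -> irreflexive c -> grid_minor c ->
    (forall p, 2 < size p -> ucycle c p -> g <= size p) ->
  g * #|darts c| <= g.*2 * #|support c| + 2 * #|darts c|.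
Proof.
move=> cs ci [n [B [b [a [conn disj contact innerB]]]]] girth.
apply: (darts_le_support_faces cs ci girth (face1_sym contact) (face2_sym contact)).
  exact: minor_cycle_cut conn disj contact innerB.
exact: minor_star_even disj contact innerB.
Qed.

Lemma grid_minor_sub (V : finType) (c c' : rel V) :
  subrel c c' -> grid_minor c' -> grid_minor c.
Proof.
move=> sub [n [B [b [a [conn disj contact innerB]]]]]; exists n, B, b, a.
by split=> // x y /sub; apply: contact.
Qed.

(** Cut the path at its last visit to [X] and then at the next visit to [Y]; as [X] and [Y] neither
    meet nor touch, something remains in between. *)
Lemma connecting_path (T : finType) (e : rel T) (X Y M : {set T}) u v :
    u \in X -> v \in Y -> connect (induced_rel e M) u v ->
    (forall p q, p \in X -> q \in Y -> p != q /\ ~~ e p q) ->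
  exists u' s v', [/\ u' \in X, v' \in Y, path e u' (rcons s v'), s != [::] &
    forall p, p \in s -> [/\ p \in M, p \notin X & p \notin Y]].
Proof.
move=> uX vY /connectP[t pt Ev] sep.
elim: {t}_.+1 {-2}t (ltnSn (size t)) u uX pt Ev => // m IHm t ltt u uX pt Ev.
case: (boolP (has (mem X) t)) => [/hasP[w wt wX]|noX].
  case/splitPr: wt ltt pt Ev => t1 t2; rewrite cat_path last_cat /= size_cat /= => ltt.
  by case/and3P => _ _ pt2 Ev; apply: (IHm t2 _ w wX pt2 Ev); lia.
have YT : has (mem Y) t.
  case: t {ltt noX} pt Ev => [_ Ev|w t _ Ev].
    by have [] := sep u v uX vY; rewrite Ev eqxx.
  by apply/hasP; exists v => //; rewrite Ev /= mem_last.
pose y := nth u t (find (mem Y) t); pose s := take (find (mem Y) t) t.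
have lt_find : find (mem Y) t < size t by rewrite -has_find.
have yY : y \in Y by apply: nth_find.
have Et : rcons s y = take (find (mem Y) t).+1 t by rewrite (take_nth u).
have {}pt : path (induced_rel e M) u (rcons s y).
  by rewrite Et; move: pt; rewrite -{1}(cat_take_drop (find (mem Y) t).+1 t) cat_path => /andP[].
have pe : path e u (rcons s y).
  by apply: sub_path pt => p q /and3P[].
exists u, s, y; split=> //.
  apply/eqP => s0; move: pe; rewrite s0 /= andbT => euy.
  by have [_] := sep u y uX yY; rewrite euy.
move=> p ps; split.
- have : all (mem M) (rcons s y).
    move: pt; move: (rcons s y) => r; clear; elim: r u => //= q r IHr u /andP[/and3P[_ _ ->]].
    exact: IHr.
  by rewrite all_rcons => /andP[_ /allP]; apply.
- by apply: contra noX => pX; apply/hasP; exists p => //; apply: mem_take ps.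
- have /negbT := before_find u (index_ltn ps).
  by rewrite nth_index //; apply: mem_take ps.
Qed.

(** * Branch sets from separated regions *)

Section Regions.
Variables (V E : finType) (c : rel V) (n : nat) (src tgt : E -> V).
Variables (R : V -> {set grid n}) (M : E -> {set grid n}).
Variables (b : V -> grid n) (m1 m2 : E -> grid n).

Local Notation adj := (@grid_adj n).
Let sep (A B : {set grid n}) := forall p q, p \in A -> q \in B -> p != q /\ ~~ adj p q.

Hypotheses (c_sym : symmetric c) (c_irr : irreflexive c).
Hypothesis c_edge : forall x y, c x y ->
  exists e, (src e = x /\ tgt e = y) \/ (src e = y /\ tgt e = x).
Hypothesis src_tgt : forall e, src e != tgt e.
Hypothesis bR : forall x, b x \in R x.
Hypothesis conn1 : forall e, connect (induced_rel adj (R (src e))) (b (src e)) (m1 e).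
Hypothesis conn2 : forall e, connect (induced_rel adj (R (tgt e))) (b (tgt e)) (m2 e).
Hypothesis connM : forall e, connect (induced_rel adj (M e)) (m1 e) (m2 e).
Hypothesis sepR : forall x y, x != y -> sep (R x) (R y).
Hypothesis sepM : forall e f, e != f -> sep (M e) (M f).
Hypothesis sepMR : forall e x, x != src e -> x != tgt e -> sep (M e) (R x).
Hypothesis innerR : forall x p, p \in R x -> inner p.
Hypothesis innerM : forall e p, p \in M e -> inner p.

Let C x := [set p | connect (induced_rel adj (R x)) (b x) p].

Let C_sub x p : p \in C x -> p \in R x.
Proof.
rewrite inE => /connectP[s]; case/lastP: s => [_ ->|s q]; first exact: bR.
by rewrite rcons_path last_rcons => /andP[_ /and3P[_ _ qR]] ->.
Qed.

Let C_conn x p : p \in C x -> connect (induced_rel adj (C x)) (b x) p.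
Proof.
rewrite inE => /connectP[s + ->]; elim/last_ind: s => [//|s q IHs].
rewrite rcons_path last_rcons => /andP[ps eq]; apply: connect_trans (IHs ps) (connect1 _).
have lC : last (b x) s \in C x by rewrite inE; apply/connectP; exists s.
have /and3P[adjq _ _] := eq; rewrite /induced_rel adjq lC inE; apply: connect_trans (connect1 eq).
by move: lC; rewrite inE.
Qed.

(** Shrink each region to the component [C x] of its base point and join the ends of [e] by a path
    in [M e]. The interior of the path goes to the branch set of [src e], and its last step is the
    contact edge. *)
Lemma minor_of_regions : grid_minor c.
Proof.
have path_ex e : exists w : grid n * seq (grid n) * grid n,
    [/\ w.1.1 \in C (src e), w.2 \in C (tgt e), path adj w.1.1 (rcons w.1.2 w.2), w.1.2 != [::] &
      forall p, p \in w.1.2 -> [/\ p \in M e, p \notin C (src e) & p \notin C (tgt e)]].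
  have [||p q pC qC|u [s [v [? ? ? ? ?]]]] := connecting_path _ _ (connM e) (X := C (src e)) (Y := C (tgt e)).
  - by rewrite inE.
  - by rewrite inE.
  - exact: sepR (src_tgt e) _ _ (C_sub pC) (C_sub qC).
  - by exists (u, s, v).
have [w0 pathP] := fin_all_exists path_ex.
pose u e := (w0 e).1.1; pose s e := (w0 e).1.2; pose v e := (w0 e).2.
have {}pathP e : [/\ u e \in C (src e), v e \in C (tgt e), path adj (u e) (rcons (s e) (v e)), s e != [::] &
    forall p, p \in s e -> [/\ p \in M e, p \notin C (src e) & p \notin C (tgt e)]] := pathP e.
pose B x := C x :|: \bigcup_(e | src e == x) [set p in s e].
have disj x y p : p \in B x -> p \in B y -> x = y.
  have CC : p \in C x -> p \in C y -> x = y.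
    move=> /C_sub px /C_sub py; apply/eqP; apply: contraT => neq.
    by have [] := sepR neq px py; rewrite eqxx.
  have CI x' y' e : p \in C x' -> src e = y' -> p \in s e -> x' = y'.
    have [_ _ _ _ sP] := pathP e.
    move=> px Ey /sP[pM p1 p2]; case: (eqVneq x' (src e)) => [->//|n1].
    case: (eqVneq x' (tgt e)) => [E2|n2]; first by rewrite -E2 px in p2.
    by have [] := sepMR n1 n2 pM (C_sub px); rewrite eqxx.
  move=> /setUP[pC|/bigcupP[e /eqP Ex pe]] /setUP[pC'|/bigcupP[f /eqP Ef pf]].
  - exact: CC.
  - by rewrite inE in pf; apply: CI pC Ef pf.
  - by rewrite inE in pe; apply/esym; apply: CI pC' Ex pe.
  - rewrite inE in pe; rewrite inE in pf.
    have [_ _ _ _ /(_ p pe)[pM _ _]] := pathP e; have [_ _ _ _ /(_ p pf)[pM' _ _]] := pathP f.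
    rewrite -Ex -Ef; case: (eqVneq e f) => [->//|nef].
    by have [] := sepM nef pM pM'; rewrite eqxx.
have BC x p : p \in C x -> p \in B x by rewrite /B => pC; rewrite in_setU pC.
have Bs e p : p \in s e -> p \in B (src e).
  by move=> ps; apply/setUP; right; apply/bigcupP; exists e; rewrite ?inE.
have conn x p : p \in B x -> connect (induced_rel adj (B x)) (b x) p.
  have connC q : q \in C x -> connect (induced_rel adj (B x)) (b x) q.
    move=> /C_conn; apply: connect_sub => p1 p2 /and3P[adj12 p1C p2C].
    by apply: connect1; rewrite /induced_rel adj12 !BC.
  case/setUP => [/connC//|/bigcupP[e /eqP Ex]]; rewrite inE => ps.
  have [uC _ pe _ _] := pathP e; rewrite Ex in uC.
  apply: connect_trans (connC _ uC) _.
  case/splitPr: ps (Bs e) pe => s1 s2 sB.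
  rewrite -cats1 -catA cat_path => /andP[p1 /andP[p2 _]].
  apply/connectP; exists (rcons s1 p); last by rewrite last_rcons.
  have uB : u e \in B x by apply: BC.
  have {p1 p2} : path adj (u e) (rcons s1 p) by rewrite rcons_path p1.
  have : all (mem (B x)) (rcons s1 p).
    apply/allP => q; rewrite mem_rcons inE => qs; rewrite -Ex; apply: sB.
    by rewrite mem_cat inE; case/orP: qs => ->; rewrite ?orbT.
  elim: (rcons s1 p) (u e) uB => //= q r IHr w wB /andP[qB rB] /andP[adjq pr].
  by rewrite /induced_rel adjq wB qB; apply: IHr.
have contact x y : c x y -> exists pq : grid n * grid n,
    [/\ pq.1 \in B x, pq.2 \in B y & adj pq.1 pq.2].
  have H e : exists pq : grid n * grid n,
      [/\ pq.1 \in B (src e), pq.2 \in B (tgt e) & adj pq.1 pq.2].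
    have [uC vC pe s0 sP] := pathP e; move: pe; rewrite rcons_path => /andP[_ adjv].
    exists (last (u e) (s e), v e); split=> //=; last exact: BC.
    by apply: Bs; case: (s e) s0 => //= q r _; apply: mem_last.
  move=> /c_edge[e [[<- <-]|[<- <-]]]; first exact: H.
  by have [[p q] [pB qB adjpq]] := H e; exists (q, p); rewrite /= grid_adj_sym.
have w_ex x y : exists pq : grid n * grid n, c x y ->
    [/\ pq.1 \in B x, pq.2 \in B y & adj pq.1 pq.2].
  by case cxy : (c x y); [have [pq pqP] := contact x y cxy; exists pq | exists (b x, b x)].
have [w wP] := fin_all_exists (fun x => fin_all_exists (w_ex x)).
(* One contact edge is used for each unordered pair, so that [a x y] and [a y x] fit together. *)
exists n, B, b, (fun x y => if enum_rank x < enum_rank y then (w x y).1 else (w y x).2).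
split=> //.
  move=> x y cxy; have cyx : c y x by rewrite c_sym.
  have [xy1 xy2 xya] := wP x y cxy; have [yx1 yx2 yxa] := wP y x cyx.
  case: (ltngtP (enum_rank x) (enum_rank y)) => [lt|lt|/val_inj/enum_rank_inj E1].
  - by split.
  - by split=> //; rewrite grid_adj_sym.
  - by move: cxy; rewrite E1 c_irr.
move=> x p /setUP[/C_sub/innerR//|/bigcupP[e _]]; rewrite inE.
by have [_ _ _ _ sP] := pathP e => /sP[/innerM].
Qed.

End Regions.

(** * From a drawing to the grid *)

From mathcomp Require Import all_order all_algebra.
From mathcomp Require Import all_classical all_reals all_analysis.
From mathcomp Require Import lra.

Import Order.TTheory GRing.Theory Num.Theory.
Import numFieldNormedType.Exports.

Local Open Scope classical_set_scope.
Local Open Scope ring_scope.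

Section Curves.
Variable R : realType.
Implicit Types f g : R -> R * R.

Lemma continuous01P f : {within `[0, 1], continuous f} <->
  forall s, s \in `[0, 1] -> forall e : R, 0 < e -> exists2 d : R, 0 < d &
    forall r, r \in `[0, 1] -> `|r - s| < d -> `|f r - f s| < e.
Proof.
split=> [/subspace_continuousP fc s s01 e e0|fc].
  have /cvgrPdist_lt /(_ e e0) := fc s s01.
  rewrite near_withinE => /nbhs_ballP[d /= d0 db]; exists d => // r r01 rs.
  by rewrite distrC; apply: db => //; rewrite /ball /= distrC.
apply/subspace_continuousP => s s01; apply/cvgrPdist_lt => e e0.
have [d d0 dP] := fc s s01 e e0; rewrite near_withinE; apply/nbhs_ballP.
by exists d => // r /= rs r01; rewrite distrC; apply: dP => //; rewrite distrC.
Qed.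

(** Connectedness of the unit interval, for a locally constant property. *)
Lemma clopen01 (P : R -> Prop) :
    (forall s, s \in `[0, 1] -> exists2 d : R, 0 < d &
       forall r, r \in `[0, 1] -> `|r - s| < d -> P s <-> P r) ->
  P 0 -> forall s, s \in `[0, 1] -> P s.
Proof.
move=> loc P0 s s01.
pose U (Q : R -> Prop) : set R := [set x | exists2 d : R, 0 < d &
  forall r, r \in `[0, 1] -> `|r - x| < d -> Q r].
have Uopen Q : open (U Q).
  rewrite openE => x [d d0 dP]; apply/nbhs_ballP; exists (d / 2); first by rewrite /= divr_gt0.
  move=> y; rewrite /ball /= => xy; exists (d / 2) => [|r r01 ry]; first by rewrite divr_gt0.
  apply: dP => //; have := ler_normD (r - y) (y - x); rewrite addrA subrK.
  by move: xy; rewrite distrC; lra.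
have conn := @segment_connected R 0 1.
have Pin : [set x | x \in `[0, 1] /\ P x] = [set` `[0, 1]].
  apply: conn.
  - by exists 0; split=> //=; rewrite in_itv /= lexx ler01.
  - exists (U P) => //; apply/seteqP; split=> x [x01 Px]; split=> //.
      by have [d d0 dP] := loc x x01; exists d => // r r01 rx; apply/(dP r r01 rx).
    by have [d d0 dP] := Px; apply: dP => //; rewrite subrr normr0.
  - exists (~` (U (fun x => ~ P x))); first exact: open_closedC.
    apply/seteqP; split=> x [x01 Px]; split=> //.
      by move=> [d d0 dP]; apply: (dP x x01) => //; rewrite subrr normr0.
    apply: contrapT => nP; apply: Px; have [d d0 dP] := loc x x01.
    by exists d => // r r01 rx /(dP r r01 rx).
by have : [set` `[0, 1]] s by []; rewrite -Pin => -[].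
Qed.

Lemma compact_curve f : {within `[0, 1], continuous f} -> compact (f @` `[0, 1]).
Proof. by move=> fc; apply: continuous_compact fc (@segment_compact _ _ _). Qed.

Lemma in01_0 : (0 : R) \in `[0, 1]. Proof. by rewrite in_itv /= lexx ler01. Qed.
Lemma in01_1 : (1 : R) \in `[0, 1]. Proof. by rewrite in_itv /= lexx ler01. Qed.

Lemma bounded_curve f : {within `[0, 1], continuous f} ->
  exists2 M : R, 0 < M & forall s, s \in `[0, 1] -> `|f s| <= M.
Proof.
move=> fc; have /compact_bounded [M [_ MP]] := compact_curve fc.
exists (`|M| + 1) => [|s s01]; first by rewrite ltr_wpDl.
by apply: (MP (`|M| + 1)); [have := ler_norm M; lra | exists s].
Qed.

(** The distance attains its minimum on the product of the two compact images. *)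
Lemma separated_curves f g :
    {within `[0, 1], continuous f} -> {within `[0, 1], continuous g} ->
    (forall s r, s \in `[0, 1] -> r \in `[0, 1] -> f s <> g r) ->
  exists2 d : R, 0 < d & forall s r, s \in `[0, 1] -> r \in `[0, 1] -> d <= `|f s - g r|.
Proof.
move=> fc gc dis.
pose K := (f @` `[0, 1]) `*` (g @` `[0, 1]).
have Kc : compact K by apply: compact_setX; apply: compact_curve.
have K0 : K !=set0 by exists (f 0, g 0); split; exists 0 => //; apply: in01_0.
pose F (x : (R * R) * (R * R)) := `|x.1 - x.2|.
have Fc : {within K, continuous F}.
  apply: continuous_subspaceT => x; apply: cvg_norm.
  by apply: cvgB; [exact: cvg_fst | exact: cvg_snd].
have [[_ _] /set_mem [[s /= s01 <-] [r /= r01 <-]] Fmin] := compact_EVT_min K0 Kc Fc.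
exists (F (f s, g r)).
  by rewrite normr_gt0 subr_eq0; apply/eqP; apply: dis.
move=> s' r' s01' r01'; apply: (Fmin (f s', g r')).
by apply/mem_set; split; [exists s' | exists r'].
Qed.

End Curves.

(** * Tracing a curve on a fine grid *)

Section Discretization.
Variables (R : realType) (M d : R) (n : nat).
Hypotheses (d_gt0 : 0 < d) (n_large : 2 * M / d + 10 <= n%:R).

(** Mesh [d]; the shift by 4 keeps everything within 2 of a curve off the rim. *)
Definition coord (x : R) : R := (x + M) / d + 4.
Definition lattice_point (q : R * R) : grid n :=
  (inord (Num.truncn (coord q.1)), inord (Num.truncn (coord q.2))).
Definition vicinity (f : R -> R * R) : {set grid n} :=
  finset (fun p : grid n => `[< exists2 s, s \in `[0, 1] &
    `|(p.1 : nat)%:R - coord (f s).1| <= 2 /\ `|(p.2 : nat)%:R - coord (f s).2| <= 2 >]).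

Let coord_bound x : `|x| <= M -> 4 <= coord x <= n%:R - 6.
Proof.
rewrite ler_norml => /andP[x1 x2]; rewrite /coord; apply/andP; split.
  by rewrite lerDr; apply: divr_ge0; [lra | exact: ltW].
have : (x + M) / d <= 2 * M / d by rewrite ler_pM2r ?invr_gt0 //; lra.
move: n_large; lra.
Qed.

Let trunc_coord x : `|x| <= M ->
  ((inord (Num.truncn (coord x)) : 'I_n.+1) : nat)%:R <= coord x < ((inord (Num.truncn (coord x)) : 'I_n.+1) : nat)%:R + 1.
Proof.
move=> /coord_bound/andP[c4 cn]; have c0 : 0 <= coord x by lra.
have /andP[t1 t2] := truncn_itv c0.
rewrite inordK; first by rewrite t1 natr1.
by rewrite ltnS -(ler_nat R); lra.
Qed.

Let pt_bound (q : R * R) : `|q| <= M -> `|q.1| <= M /\ `|q.2| <= M.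
Proof. by rewrite prod_normE ge_max => /andP[]. Qed.

Let coordB x y : coord x - coord y = (x - y) / d.
Proof. by rewrite /coord opprD addrACA subrr addr0 -mulrBl opprD addrACA subrr addr0. Qed.

Lemma lattice_point_vicinity (f : R -> R * R) (s : R) : (forall s, s \in `[0, 1] -> `|f s| <= M) -> s \in `[0, 1] ->
  lattice_point (f s) \in vicinity f.
Proof.
move=> fM s01; have [b1 b2] := pt_bound (fM s s01).
rewrite inE; apply/asboolP; exists s => //.
have /andP[t1 t2] := trunc_coord b1; have /andP[u1 u2] := trunc_coord b2.
by rewrite /lattice_point /= !ler_norml; split; lra.
Qed.

Lemma vicinity_inner (f : R -> R * R) (p : grid n) : (forall s, s \in `[0, 1] -> `|f s| <= M) ->
  p \in vicinity f -> inner p.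
Proof.
move=> fM; rewrite inE => /asboolP[s s01]; have [b1 b2] := pt_bound (fM s s01).
have /andP[t1 t2] := coord_bound b1; have /andP[u1 u2] := coord_bound b2.
rewrite !ler_norml => -[/andP[v1 v2] /andP[w1 w2]].
by rewrite /inner -!(ltr_nat R); apply/and4P; split; lra.
Qed.

(** In the maximum norm, a scaled distance of 10 less 2 on either side leaves 6 in some coordinate,
    too much for equal or adjacent points. *)
Lemma vicinity_sep (f g : R -> R * R) :
    (forall s r, s \in `[0, 1] -> r \in `[0, 1] -> 10 * d <= `|f s - g r|) ->
  forall p q, p \in vicinity f -> q \in vicinity g -> p != q /\ ~~ grid_adj p q.
Proof.
move=> sep p q; rewrite inE => /asboolP[s s01 [p1 p2]].
rewrite inE => /asboolP[r r01 [q1 q2]].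
have far : 6 <= `|(p.1 : nat)%:R - (q.1 : nat)%:R : R| \/ 6 <= `|(p.2 : nat)%:R - (q.2 : nat)%:R : R|.
  have large x y : 10 * d <= `|x - y| -> 10 <= `|coord x - coord y|.
    by rewrite coordB normrM normfV (gtr0_norm d_gt0) ler_pdivlMr.
  have := sep s r s01 r01; rewrite prod_normE le_max => /orP[] /large far; [left|right].
    by move: far p1 q1; rewrite !ler_norml !ler_normr; lra.
  by move: far p2 q2; rewrite !ler_norml !ler_normr; lra.
have close (a b : nat) : 6 <= `|a%:R - b%:R : R| -> [/\ (a != b)%N, (a.+1 != b)%N & (b.+1 != a)%N].
  move=> ab; split; apply/eqP => E; move: ab.
  - by rewrite E subrr normr0; lra.
  - by rewrite -E -(natr1 a) opprD addrA subrr sub0r normrN1; lra.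
  - by rewrite -E -(natr1 b) addrAC subrr add0r normr1; lra.
have nat_ne (i j : 'I_n.+1) : (i != j :> nat) -> i != j by apply: contra => /eqP->.
case: far => /close[n1 n2 n3]; have := nat_ne _ _ n1 => n4; split.
- by apply: contra n4 => /eqP->.
- by rewrite /grid_adj (negPf n2) (negPf n3) (negPf n4) andbF.
- by apply: contra n4 => /eqP->.
- by rewrite /grid_adj (negPf n2) (negPf n3) (negPf n4) andbF.
Qed.

(** Being connected to the start is locally constant in [s]: while [f] moves by less than [d], each
    rounded coordinate changes by at most 1, and the corner [(a', b)] is still in the vicinity. *)
Lemma vicinity_connected (f : R -> R * R) (s : R) : {within `[0, 1], continuous f} ->
    (forall s, s \in `[0, 1] -> `|f s| <= M) -> s \in `[0, 1] ->
  connect (induced_rel (@grid_adj n) (vicinity f)) (lattice_point (f 0)) (lattice_point (f s)).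
Proof.
move=> /continuous01P fc fM s01; set e := induced_rel _ _.
have esym : connect_sym e.
  apply: sym_connect_sym => p q; rewrite /e /induced_rel grid_adj_sym; congr (_ && _).
  by rewrite andbC.
apply: (clopen01 (P := fun s => connect e (lattice_point (f 0)) (lattice_point (f s)))) s01; last first.
  exact: connect0.
move=> {}s s01; have [z z0 zP] := fc s s01 d d_gt0; exists z => // r r01 rs.
suff c : connect e (lattice_point (f s)) (lattice_point (f r)).
  split=> [|] h; first exact: connect_trans h c.
  by apply: connect_trans h _; rewrite esym.
have [/= near1 near2] : `|coord (f r).1 - coord (f s).1| < 1 /\ `|coord (f r).2 - coord (f s).2| < 1.
  have := zP r r01 rs; rewrite prod_normE gt_max => /andP[h1 h2].
  by rewrite !coordB !normrM normfV (gtr0_norm d_gt0) !ltr_pdivrMr // !mul1r.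
have [bs1 bs2] := pt_bound (fM s s01); have [br1 br2] := pt_bound (fM r r01).
have /andP[] := trunc_coord bs1; have /andP[] := trunc_coord bs2.
have /andP[] := trunc_coord br1; have /andP[] := trunc_coord br2.
rewrite /lattice_point; set a' := inord (Num.truncn (coord (f r).1)); set b' := inord (Num.truncn (coord (f r).2)).
set a := inord (Num.truncn (coord (f s).1)); set b := inord (Num.truncn (coord (f s).2)).
move=> hb1' hb2' ha1' ha2' hb1 hb2 ha1 ha2.
move: near1 near2; rewrite !ltr_norml => /andP[n1 n2] /andP[n3 n4].
have close (i j : 'I_n.+1) : (i : nat)%:R < (j : nat)%:R + (2 : R) -> (j : nat)%:R < (i : nat)%:R + (2 : R) ->
    [\/ i = j, i.+1 = j | j.+1 = i].
  rewrite -!natrD !ltr_nat => h1 h2; case: (eqVneq i j) => [->|ne]; first by constructor 1.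
  move: (ne) h1 h2; rewrite -val_eqE !addn2 /= => h3 h1 h2.
  have [E|E] : i.+1 = j \/ j.+1 = i by move: h1 h2 h3; clear; lia.
    by constructor 2.
  by constructor 3.
have inv (p : grid n) t : t \in `[0, 1] -> `|(p.1 : nat)%:R - coord (f t).1| <= 2 ->
    `|(p.2 : nat)%:R - coord (f t).2| <= 2 -> p \in vicinity f.
  by move=> t01 h1 h2; rewrite inE; apply/asboolP; exists t.
have v1 : (a, b) \in vicinity f by apply: (inv _ s) => //=; rewrite ler_norml; lra.
have v2 : (a', b) \in vicinity f by apply: (inv _ r) => //=; rewrite ler_norml; lra.
have v3 : (a', b') \in vicinity f by apply: (inv _ r) => //=; rewrite ler_norml; lra.
have step1 : connect e (a, b) (a', b).
  have [->//|E|E] : [\/ a = a', a.+1 = a' | a'.+1 = a] by apply: close; lra.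
    by apply: connect1; rewrite /e /induced_rel v1 v2 /grid_adj /= eqxx E eqxx.
  by apply: connect1; rewrite /e /induced_rel v1 v2 /grid_adj /= eqxx E eqxx orbT.
apply: connect_trans step1 _.
have [->//|E|E] : [\/ b = b', b.+1 = b' | b'.+1 = b] by apply: close; lra.
  by apply: connect1; rewrite /e /induced_rel v2 v3 /grid_adj /= !eqxx E eqxx orbT.
by apply: connect1; rewrite /e /induced_rel v2 v3 /grid_adj /= !eqxx E eqxx !orbT.
Qed.

End Discretization.

Lemma fin_min_pos (R : realType) (I : finType) (P : I -> R -> Prop) :
    (forall i d d', 0 < d' -> d' <= d -> P i d -> P i d') ->
    (forall i, exists2 d : R, 0 < d & P i d) ->
  exists2 d : R, 0 < d & forall i, P i d.
Proof.
move=> anti ex; have ex' i : exists d : R, 0 < d /\ P i d by have [d] := ex i; exists d.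
have [f fP] := fin_all_exists ex'.
have pos : 0 < \big[Num.min/1]_i f i by apply: lt_bigmin => // i _; case: (fP i).
exists (\big[Num.min/1]_i f i) => // i; have [fi Pi] := fP i.
by apply: anti Pi => //; apply: bigmin_le_cond.
Qed.

Lemma connect_induced_sub (T : finType) (e : rel T) (A B : {set T}) x y :
  {subset A <= B} -> connect (induced_rel e A) x y -> connect (induced_rel e B) x y.
Proof.
move=> sub; apply: connect_sub => p q /and3P[epq pA qA].
by apply: connect1; rewrite /induced_rel epq !sub.
Qed.

(** * The grid minor of a drawing *)

Section Drawing.
Variables (R : realType) (G : sgraph) (pos : G -> R * R) (arc : edge G -> R -> R * R).
Hypothesis pos_inj : injective pos.
Hypothesis arc_cont : forall e, {within `[0, 1], continuous (arc e)}.
Hypothesis arc_inj : forall e, {in `[0, 1] &, injective (arc e)}.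
Hypothesis arc_ends : forall e, [set arc e 0; arc e 1] = [set pos x | x in [set` val e]].
Hypothesis arc_pos : forall e s x, s \in `]0, 1[ -> arc e s <> pos x.
Hypothesis arc_arc : forall e f r s, e != f -> r \in `]0, 1[ -> s \in `]0, 1[ -> arc e r <> arc f s.

Let ends e : exists xy : G * G, [/\ arc e 0 = pos xy.1, arc e 1 = pos xy.2,
  xy.1 != xy.2, xy.1 \in val e & xy.2 \in val e].
Proof.
have : [set pos x | x in [set` val e]] (arc e 0) by rewrite -arc_ends; left.
case=> x /= xe Ex.
have : [set pos x | x in [set` val e]] (arc e 1) by rewrite -arc_ends; right.
case=> y /= ye Ey.
exists (x, y); split=> //; apply/eqP => /= xy.
have : (0 : R) = 1 by apply: (@arc_inj e _ _ (in01_0 R) (in01_1 R)); rewrite -Ex -Ey xy.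
by move/eqP; rewrite eq_sym oner_eq0.
Qed.

Let third (i : 'I_3) (s : R) : R := ((i : nat)%:R + s) / 3.

(** Constant curves at the vertices and the thirds of all arcs, in one finite family, so that common
    constants [M] and [d] can be chosen. *)
Let curve (j : G + edge G * 'I_3) (s : R) : R * R :=
  match j with inl x => pos x | inr (e, i) => arc e (third i s) end.

Let third01 i s : s \in `[0, 1] -> third i s \in `[0, 1].
Proof.
rewrite !in_itv /third /= => /andP[s0 s1].
have i2 : (i : nat)%:R <= (2 : R) by rewrite ler_nat -ltnS.
have i0 : 0 <= (i : nat)%:R :> R by [].
by apply/andP; split; lra.
Qed.

Let curve_cont j : {within `[0, 1], continuous (curve j)}.
Proof.
apply/continuous01P => s s01 e e0; case: j => [x|[f i]] /=.
  by exists 1 => // r _ _; rewrite subrr normr0.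
have /continuous01P/(_ _ (third01 i s01) e e0)[d d0 dP] := @arc_cont f.
exists d => // r r01 rs; apply: dP; first exact: third01.
have -> : third i r - third i s = (r - s) / 3 by rewrite /third; lra.
rewrite normrM normfV (ger0_norm (ler0n _ 3)); apply: le_lt_trans rs.
by rewrite ler_pdivrMr //; have := normr_ge0 (r - s); lra.
Qed.

(** The region of a vertex is the vicinity of its point and of the end thirds there; the middle
    thirds give the connections. Curves of the family that are disjoint have positive distance, and
    one fine grid serves all pairs. *)
Lemma drawing_grid_minor : grid_minor (@adj G).
Proof.
have [st stP] := fin_all_exists ends.
pose src e := (st e).1; pose tgt e := (st e).2.
have src_pos e : arc e 0 = pos (src e) by have [] := stP e.
have tgt_pos e : arc e 1 = pos (tgt e) by have [] := stP e.
have src_tgt e : src e != tgt e by have [] := stP e.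
have curve_bound : exists M : R, forall j s, s \in `[0, 1] -> `|curve j s| <= M.
  (* Inverting turns a common upper bound into an instance of [fin_min_pos]. *)
  have [N N0 NP] : exists2 d : R, 0 < d & forall j, forall s, s \in `[0, 1] -> `|curve j s| <= d^-1.
    apply: fin_min_pos => [j d d' d'0 le H s s01|j].
      by apply: le_trans (H s s01) _; rewrite lef_pV2 // posrE // (lt_le_trans d'0).
    have [N N0 NP] := bounded_curve (@curve_cont j).
    by exists N^-1; rewrite ?invr_gt0 // => s s01; rewrite invrK; apply: NP.
  by exists N^-1.
have [M MP] := curve_bound.
pose apart j j' := forall s r, s \in `[0, 1] -> r \in `[0, 1] -> curve j s <> curve j' r.
have [d d0 dP] : exists2 d : R, 0 < d & forall jj : (G + edge G * 'I_3) * (G + edge G * 'I_3),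
    apart jj.1 jj.2 -> forall s r, s \in `[0, 1] -> r \in `[0, 1] -> 10 * d <= `|curve jj.1 s - curve jj.2 r|.
  apply: fin_min_pos => [jj d d' _ le H ap s r s01 r01|[j j']].
    by apply: le_trans (H ap s r s01 r01); rewrite ler_pM2l.
  case: (pselect (apart j j')) => [ap|nap]; last by exists 1.
  have [d d0 dP] := separated_curves (@curve_cont j) (@curve_cont j') ap.
  exists (d / 10); first by rewrite divr_gt0.
  by move=> _ s r s01 r01; rewrite mulrC divfK //; apply: dP.
pose n := (Num.truncn (2 * M / d + 10)).+1.
have n_large : 2 * M / d + 10 <= n%:R by apply/ltW/truncnS_gt.
pose lat := @lattice_point R M d n.
pose vic := @vicinity R M d n.
pose own (j : G + edge G * 'I_3) (x : G) := match j with
  | inl y => y == x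
  | inr (e, i) => ((i == 0 :> nat) && (src e == x)) || ((i == 2 :> nat) && (tgt e == x)) end.
pose reg x : {set grid n} := (\bigcup_(j | own j x) vic (curve j))%SET.
pose mid e := vic (curve (inr (e, inord 1))).
have i1 : (inord 1 : 'I_3) = 1%N :> nat by rewrite inordK.
have inside (t : R) : t \in `[0, 1] -> t != 0 -> t != 1 -> t \in `]0, 1[.
  by rewrite !in_itv /= !lt_neqAle => /andP[-> ->] t0 t1; rewrite eq_sym t0 t1.
(* Away from the vertex itself such a point is interior to an arc, where the drawing conditions
   apply; the bounds on [t] separate the two end thirds of one arc. *)
have own_pt (j : G + edge G * 'I_3) (x : G) (s : R) : own j x -> s \in `[0, 1] -> curve j s = pos x \/ exists e t,
    [/\ t \in `]0, 1[, curve j s = arc e t & (src e = x /\ t <= 3^-1) \/ (tgt e = x /\ 2 / 3 <= t)].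
  move=> oj s01; case: j oj => [y /eqP->|[e i] oj]; first by left.
  have t01 := third01 i s01; have := s01; rewrite in_itv /= => /andP[s0 s1].
  case: (eqVneq (third i s) 0) => [t0|t0].
    left; rewrite /curve t0 src_pos; case/orP: oj => /andP[/eqP i_ /eqP<-] //.
    by exfalso; move: t0; rewrite /third i_; lra.
  case: (eqVneq (third i s) 1) => [t1|t1].
    left; rewrite /curve t1 tgt_pos; case/orP: oj => /andP[/eqP i_ /eqP<-] //.
    by exfalso; move: t1; rewrite /third i_; lra.
  right; exists e, (third i s); split=> //; first exact: inside.
  case/orP: oj => /andP[/eqP i_ /eqP Ex]; [left|right]; split=> //; rewrite /third i_; lra.
have mid_pt e s : s \in `[0, 1] -> exists2 t, t \in `]0, 1[ & curve (inr (e, inord 1)) s = arc e t.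
  rewrite in_itv /= => /andP[s0 s1]; exists (third (inord 1) s) => //.
  by rewrite in_itv /third i1 /=; apply/andP; split; lra.
have sub01 t : t \in `]0, 1[ -> (t : R) \in `[0, 1].
  by rewrite !in_itv /= => /andP[/ltW-> /ltW->].
have arcE e f t t' : t \in `]0, 1[ -> t' \in `]0, 1[ -> arc e t = arc f t' -> e = f /\ t = t'.
  move=> t01 t01' E; case: (eqVneq e f) => [ef|ef]; last by case: (arc_arc ef t01 t01' E).
  by subst f; split=> //; apply: (arc_inj (sub01 _ t01) (sub01 _ t01') E).
have vsep (j j' : G + edge G * 'I_3) : apart j j' -> forall p q, p \in vic (curve j) -> q \in vic (curve j') ->
    p != q /\ ~~ grid_adj p q.
  by move=> ap; apply: vicinity_sep => // s r s01 r01; apply: (dP (j, j')).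
have vconn (j : G + edge G * 'I_3) (s : R) (s01 : s \in `[0, 1]) :=
  vicinity_connected d0 n_large (@curve_cont j) (MP j) s01.
have third0 i : third i 0 = (i : nat)%:R / 3 by rewrite /third addr0.
have third1 i : third i 1 = ((i : nat)%:R + 1) / 3 by [].
have reg_sub j x : own j x -> {subset vic (curve j) <= reg x}.
  by move=> oj p pv; apply/finset.bigcupP; exists j.
have csym (A : {set grid n}) : connect_sym (induced_rel (@grid_adj n) A).
  apply: sym_connect_sym => p q.
  by rewrite /induced_rel grid_adj_sym; congr (_ && _); rewrite andbC.
have c_edge x y : adj x y -> exists e, (src e = x /\ tgt e = y) \/ (src e = y /\ tgt e = x).
  move=> xy; have eE : [set x; y]%SET \in edges G.
    by rewrite inE; apply/existsP; exists x; apply/existsP; exists y; rewrite xy eqxx.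
  pose e : edge G := (exist _ [set x; y]%SET eE : {A : {set G} | A \in edges G}); exists e.
  have [h1 h2] : src e \in [set x; y]%SET /\ tgt e \in [set x; y]%SET by have [] := stP e.
  have := src_tgt e.
  by case/set2P: h1 => ->; case/set2P: h2 => ->; rewrite ?eqxx //; auto.
apply: (@minor_of_regions _ _ _ n src tgt reg mid (fun x => lat (pos x))
  (fun e => lat (arc e (1 / 3))) (fun e => lat (arc e (2 / 3)))) => //.
- exact: adj_sym.
- exact: adj_irrefl.
- move=> x; apply: (reg_sub (inl x)); first by rewrite /own.
  apply: (@lattice_point_vicinity _ _ _ _ d0 n_large (curve (inl x)) 0 (MP (inl x))).
  exact: in01_0.
- move=> e; apply: (connect_induced_sub (reg_sub (inr (e, inord 0)) _ _)).
    by rewrite /own inordK // eqxx.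
  have := vconn (inr (e, inord 0)) 1 (in01_1 R).
  by rewrite /curve third0 third1 inordK // mul0r add0r src_pos.
- move=> e; apply: (connect_induced_sub (reg_sub (inr (e, inord 2)) _ _)).
    by rewrite /own inordK // eqxx orbT.
  have := vconn (inr (e, inord 2)) 1 (in01_1 R).
  rewrite /curve third0 third1 inordK // (_ : (2 + 1) / 3 = 1 :> R); last by lra.
  by rewrite tgt_pos csym.
- move=> e; have := vconn (inr (e, inord 1)) 1 (in01_1 R).
  by rewrite /curve third0 third1 inordK.
- move=> x y xy p q /finset.bigcupP[j oj pj] /finset.bigcupP[j' oj' qj'].
  apply: vsep pj qj' => s r s01 r01.
  case: (own_pt _ _ _ oj s01) => [->|[e [t [t01 -> Ht]]]]; case: (own_pt _ _ _ oj' r01) => [->|[f [t' [t01' -> Ht']]]].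
  + by move/pos_inj => Exy; rewrite Exy eqxx in xy.
  + by move/esym; apply: arc_pos.
  + exact: arc_pos.
  + move/(arcE _ _ _ _ t01 t01') => [Ef Et]; subst f t'.
    case: Ht Ht' => [[E1 l1]|[E1 l1]] [[E2 l2]|[E2 l2]].
    * by rewrite -E1 -E2 eqxx in xy.
    * by exfalso; move: l1 l2; lra.
    * by exfalso; move: l1 l2; lra.
    * by rewrite -E1 -E2 eqxx in xy.
- move=> e f ef p q pe qf; apply: vsep pe qf => s r s01 r01.
  have [t t01 ->] := mid_pt e s s01; have [t' t01' ->] := mid_pt f r r01.
  by move/(arcE _ _ _ _ t01 t01') => [Ef _]; rewrite Ef eqxx in ef.
- move=> e x xs xt p q pe /finset.bigcupP[j oj qj].
  apply: vsep pe qj => s r s01 r01; have [t t01 ->] := mid_pt e s s01.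
  case: (own_pt _ _ _ oj r01) => [->|[f [t' [t01' -> Ht]]]]; first exact: arc_pos.
  move/(arcE _ _ _ _ t01 t01') => [Ef _]; subst f.
  by case: Ht => [[E _]|[E _]]; [rewrite E eqxx in xs | rewrite E eqxx in xt].
- move=> x p /finset.bigcupP[j _ pj].
  exact (vicinity_inner d0 n_large (MP j) pj).
- move=> e p pe; exact (vicinity_inner d0 n_large (MP (inr (e, inord 1))) pe).
Qed.

End Drawing.

Lemma planar_grid_minor (R : realType) (G : sgraph) : planar R G -> grid_minor (@adj G).
Proof.
move=> [pos [arc [pinj arcc ends apos aarc]]].
apply: (@drawing_grid_minor R G pos arc) => //.
- by move=> e; case: (arcc e).
- by move=> e; case: (arcc e).
Qed.

(** * Girth and edge colourings of simple graphs *)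

Local Open Scope nat_scope.

Lemma ohead_filter_iota (P : pred nat) a N m :
  ohead [seq n <- iota a N | P n] = Some m ->
  P m /\ forall n, a <= n < a + N -> P n -> m <= n.
Proof.
elim: N a => [//|N IHN] a /=; case: ifP => [Pa [<-]|Pa /IHN[Pm mmin]].
  by split=> // n /andP[].
split=> // n /andP[lean ltn] Pn; apply: mmin => //.
rewrite addSnnS ltn andbT ltn_neqAle lean andbT.
by apply: contraFneq Pa => ->.
Qed.

Lemma ohead_filter_iota_none (P : pred nat) a N n :
  ohead [seq n <- iota a N | P n] = None -> a <= n < a + N -> ~~ P n.
Proof.
case E : [seq _ <- _ | _] => [|//] _ an.
apply/negP => Pn; have : n \in [seq n <- iota a N | P n] by rewrite mem_filter Pn mem_iota.
by rewrite E.
Qed.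

Lemma girth_le (G : sgraph) (g : nat) (p : seq G) :
  ext_leq (Some g) (girth G) -> 2 < size p -> ucycle (@adj G) p -> g <= size p.
Proof.
move=> gG p2 cp; have cyc : has_cycle G (size p).
  by rewrite /has_cycle p2; apply/existsP; exists (in_tuple p); exact: cp.
have szp : size p < #|G|.+1.
  by have /andP[_ /card_uniqP <-] := cp; rewrite ltnS max_card.
move: gG; rewrite /girth; case E : (ohead _) => [m|].
  by have [_ mmin] := ohead_filter_iota E => /leq_trans; apply; apply: mmin.
by have := ohead_filter_iota_none E (n := size p); rewrite cyc => /(_ szp).
Qed.

(** A walk of [n] steps in the line graph yields [n] shared vertices; successive ones are equal or
    joined by the edge in between, so [n.-1] steps suffice. *)
Lemma line_path_within (G : sgraph) (e : edge G) (p : seq (edge G)) :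
    path (@line_adj G) e p -> p != [::] ->
  exists x y, [/\ x \in val e, y \in val (last e p) & walk_le (@adj G) (size p).-1 x y].
Proof.
elim: p e => // e1 p IHp e /= /andP[/andP[_ /set0Pn[x]]]; rewrite finset.in_setI => /andP[xe xe1] pp _.
case: p IHp pp => [_ _|e2 p IHp pp].
  by exists x, x; split=> //; apply: walk_le_refl.
have [x1 [y [x1e ye w]]] := IHp e1 pp isT; exists x, y; split=> //.
have /edge_setP[u [v [huv E]]] : val e1 \in edge_set (@adj G) := valP e1.
case: (eqVneq x x1) => [->|xx1]; first exact: walk_leS w.
apply: walk_le_step w; move: xe1 x1e xx1; rewrite E => /set2P[]-> /set2P[]->; rewrite ?eqxx //.
by rewrite adj_sym.
Qed.

Lemma dist_edge_colorable_of_colorable (G : sgraph) (t K : nat) : 0 < t ->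
  colorable (@adj G) t.-1 K -> dist_edge_colorable t G K.
Proof.
move=> t0 [col colP]; apply/existsP; exists [ffun e => col (val e)].
apply/forallP => e; apply/forallP => f; apply/implyP => /andP[ef].
rewrite /distance; case E : (ohead _) => [m|//] /= lemt.
have [/existsP[p /andP[pp /eqP lp]] _] := ohead_filter_iota E.
rewrite !ffunE; apply: colP; [exact: valP | exact: valP | by rewrite val_eqE |].
have p0 : val p != [::] :> seq (edge G).
  by apply: contra ef => /eqP p0; rewrite -lp p0.
have [x [y [xe yf w]]] := line_path_within pp p0.
apply/orP; right; apply/exists_inP; exists x => //; apply/exists_inP.
exists y; first by rewrite -lp.
by apply: walk_le_mono w; rewrite size_tuple; lia.
Qed.


(** * The closed form of the bound and its application *)

Local Open Scope ring_scope.

(** A geometric sum of ratio [d.-1], with denominator [d - 2 = (d - 1) - 1]. *)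
Lemma tauE (R : realType) (t d : nat) : (2 < d)%N ->
  tau R t d = (d * \sum_(i < t.+1./2) d.-1 ^ i)%N%:R.
Proof.
move=> d2; have d2R : d%:R - 2 != 0 :> R by rewrite subr_eq0 eqr_nat; lia.
apply: (mulfI d2R); rewrite /tau mulrA divff // mul1r.
have dR : d%:R - 1 = d.-1%:R :> R by rewrite -subn1 natrB //; lia.
rewrite natrM natr_sum mulrCA.
under eq_bigr do rewrite natrX.
have -> : d%:R - 2 = d.-1%:R - 1 :> R by rewrite -dR; lra.
by rewrite -subrX1 dR mulrBr mulr1.
Qed.

Theorem theorem4p2 (R : realType) (t d : nat) (G : sgraph)
  (t_ge3 : (3 <= t)%N) (t_odd : odd t)
  (G_planar : planar R G)
  (G_maxdeg : max_degree G = d) (d_ge : (t + 2 <= d)%N)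
  (G_girth : ext_leq (Some (30 * t - 6)%N) (girth G)) :
  (dist_chromatic_index t G)%:R <= tau R t d.
Proof.
rewrite tauE; last by lia.
rewrite ler_nat /dist_chromatic_index; case: ex_minnP => m _; apply.
apply: dist_edge_colorable_of_colorable; first by lia.
(* In terms of [k], the condition [t + 2 <= d] becomes [k.*2 < d]. *)
set k := t.+1./2; have tk : t = k.*2.-1 by rewrite /k; lia.
have -> : t.-1 = k.-1.*2 by lia.
have adjs := @adj_sym G; have adji := @adj_irrefl G.
apply: colorable_of_far_core => //; [by lia | by lia | |].
  move=> x; rewrite -G_maxdeg; apply: leq_trans (leq_bigmax x).
  by rewrite /degree /nbrs cardsE.
move=> c cs csub cne c1; have ci : irreflexive c.
  by move=> x; apply/negP => /csub; rewrite adji.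
(* With [r = 3 * k - 2] the girth condition is [36 * k - 18 < 60 * k - 36], which holds as
   [2 <= k]. *)
apply: (far_core_of_sparse (g := 30 * t - 6) cs cne c1); last by lia.
apply: minor_sparse => //; first exact: grid_minor_sub csub (planar_grid_minor G_planar).
move=> p p2 /andP[cp up]; apply: girth_le G_girth p2 _.
by apply/andP; split=> //; case: (p) cp => //= x q; apply: sub_path.
Qed.
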